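(* Let $(\Sigma^n,\sigma)$ be a compact, connected Riemannian manifold, let $t_0<t_1$ be real numbers and $M=[t_0,t_1]\times\Sigma$. For each $j\in\mathbb{N}\cup\{\infty\}$ let $f_j:[t_0,t_1]\to(0,\infty)$ be continuous and let $g_j=-dt^2+f_j(t)^2\sigma$ be the corresponding warped product Lorentzian metric on $M$. Let $\tau:M\to\mathbb{R}$ be the time function depending only on the $t$-coordinate given by $$\tau(t)=\int_{t_0}^t\frac{1}{f_\infty(r)}\,dr .$$ Suppose that $$\int_{t_0}^{t_1}|f_j-f_\infty|\,dt\to 0\quad\text{as } j\to\infty,$$ and that for all $j\in\mathbb{N}$ $$f_j(t)\ge f_\infty(t)\quad\text{for all } t\in[t_0,t_1].$$ Then the null distances $\hat d_{\tau,g_j}$ converge uniformly to $\hat d_{\tau,g_\infty}$ on $M\times M$, i.e. $$\sup_{p,q\in M}\left|\hat d_{\tau,g_j}(p,q)-\hat d_{\tau,g_\infty}(p,q)\right|\to 0\quad\text{as } j\to\infty .$$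
   Context: Each $(M,g_j)$ is time oriented so that $\partial_t$ is future directed. A time function on a spacetime $(M,g)$ is a continuous function $\tau:M\to\mathbb{R}$ that is strictly increasing along all future-directed causal curves. A piecewise causal curve with respect to $g$ is a piecewise smooth curve $\beta:[a,b]\to M$ with a partition $a=s_0<s_1<\dots<s_k=b$ such that on each piece $[s_{i-1},s_i]$ the curve is either future-directed causal or past-directed causal with respect to $g$. Its null length is $$\hat L_{\tau,g}(\beta)=\sum_{i=1}^k|\tau(\beta(s_i))-\tau(\beta(s_{i-1}))|.$$ The null distance between $p,q\in M$ is $$\hat d_{\tau,g}(p,q)=\inf\{\hat L_{\tau,g}(\beta):\beta\text{ is a piecewise causal curve (with respect to } g)\text{ from } p\text{ to } q\}.$$ *)

(* Defs.v *)
From mathcomp Require Import all_boot all_order all_algebra.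
From mathcomp Require Import all_classical all_reals all_analysis.

Set Implicit Arguments.
Unset Strict Implicit.
Unset Printing Implicit Defensive.

Import Order.TTheory GRing.Theory Num.Theory.
Import numFieldNormedType.Exports.

Local Open Scope classical_set_scope.
Local Open Scope ring_scope.

(* [foldr ... vs] is the iterated directional derivative of [f] along [vs]:
   on an open set [U] (the only use below), [smooth_on U f] says that [f] is
   C^infinity on [U]. *)
Definition smooth_on (R : realType) (V W : normedModType R)
    (U : set V) (f : V -> W) : Prop :=
  forall (vs : seq V) (x : V), U x ->
    let g : V -> W := foldr (fun v h => 'D_v h) f vs in
    {for x, continuous g} /\ (forall v : V, derivable g x v).

Record chart (R : realType) (n : nat) (S : topologicalType) := Chart {
  cdom : set S;
  cmap : S -> 'rV[R]_n;
  cinv : 'rV[R]_n -> S;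
  cdom_open : open cdom;
  cimg_open : open (cmap @` cdom);
  cmapK : forall x, cdom x -> cinv (cmap x) = x;
  cmap_continuous : forall x, cdom x -> {for x, continuous cmap};
  cinv_continuous : forall y, (cmap @` cdom) y -> {for y, continuous cinv} }.

Record smoothManifold (R : realType) (n : nat) (S : topologicalType) :=
  SmoothManifold {
  atlas : set (chart R n S);
  manifold_hausdorff : hausdorff_space S;
  manifold_second_countable : @second_countable S;
  atlas_cover : forall x : S, exists2 c, atlas c & cdom c x;
  atlas_smooth : forall c c', atlas c -> atlas c' ->
    smooth_on (cmap c @` (cdom c `&` cdom c')) (cmap c' \o cinv c) }.

(* [rmetric c x] is the Gram matrix of the metric at [x] in the coordinate
   basis of the chart [c]. Tangent vectors are coordinate row vectors, so a
   change of charts acts on them by [v |-> v *m J] with [J] the (row-vector)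
   Jacobian of the transition map; see [deriveEjacobian]. *)
Record riemannianMetric (R : realType) (n : nat) (S : topologicalType)
    (X : smoothManifold R n S) := RiemannianMetric {
  rmetric : chart R n S -> S -> 'M[R]_n;
  rmetric_sym : forall c x, atlas X c -> cdom c x ->
    (rmetric c x)^T = rmetric c x;
  rmetric_pos : forall c x (v : 'rV[R]_n), atlas X c -> cdom c x -> v != 0 ->
    0 < (v *m rmetric c x *m v^T) 0 0;
  rmetric_smooth : forall c (i j : 'I_n), atlas X c ->
    smooth_on (cmap c @` cdom c) (fun y => rmetric c (cinv c y) i j : R);
  rmetric_change : forall c c' x, atlas X c -> atlas X c' ->
    cdom c x -> cdom c' x ->
    let J := jacobian (cmap c' \o cinv c) (cmap c x) in
    rmetric c x = J *m rmetric c' x *m J^T }.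

Section WarpedProduct.
Context (R : realType) (n : nat) (S : topologicalType).
Context (X : smoothManifold R n S) (sigma : riemannianMetric X).
Implicit Types (t : R) (f : R -> R) (beta : R -> R * S).

Definition spacetime t0 t1 : set (R * S) := `[t0, t1]%classic `*` [set: S].

(* The metric -dt^2 + f(t)^2 sigma at [p]; a tangent vector is given by its
   t-component and its coordinates in the chart [c] around [p.2]. *)
Definition warped_metric f (c : chart R n S) (p : R * S)
    (v w : R * 'rV[R]_n) : R :=
  - (v.1 * w.1) + f p.1 ^+ 2 * (v.2 *m rmetric sigma c p.2 *m w.2^T) 0 0.

Definition partial_t : R * 'rV[R]_n := (1, 0).

Definition causal f c p v : Prop := v != 0 /\ warped_metric f c p v v <= 0.

Definition future_causal f c p v : Prop :=
  causal f c p v /\ warped_metric f c p v partial_t < 0.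

Definition past_causal f c p v : Prop :=
  causal f c p v /\ 0 < warped_metric f c p v partial_t.

Definition smooth_curve_on (U : set R) beta : Prop :=
  [/\ smooth_on U (fst \o beta : R -> R),
      forall s, U s -> {for s, continuous (snd \o beta)} &
      forall c, atlas X c ->
        smooth_on (U `&` [set s | cdom c (beta s).2])
          (fun s => cmap c (beta s).2)].

Definition velocity (c : chart R n S) beta (s : R) : R * 'rV[R]_n :=
  (derive1 (fst \o beta) s, derive1 (fun r => cmap c (beta r).2) s).

(* Smoothness on the closed interval [a, b] means, as usual, the existence of a
   smooth extension to a neighbourhood, here with values in the boundaryless
   manifold R x Sigma. *)
Definition smooth_extension (a b : R) beta alpha : Prop :=
  (exists U : set R, [/\ open U, `[a, b]%classic `<=` U &
                         smooth_curve_on U alpha]) /\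
  (forall s, `[a, b]%classic s -> alpha s = beta s).

Definition future_causal_curve f (a b : R) beta : Prop :=
  exists2 alpha, smooth_extension a b beta alpha &
    forall s c, `[a, b]%classic s -> atlas X c -> cdom c (alpha s).2 ->
      future_causal f c (alpha s) (velocity c alpha s).

Definition past_causal_curve f (a b : R) beta : Prop :=
  exists2 alpha, smooth_extension a b beta alpha &
    forall s c, `[a, b]%classic s -> atlas X c -> cdom c (alpha s).2 ->
      past_causal f c (alpha s) (velocity c alpha s).

(* [a :: s] lists the points s_0 < ... < s_k of the partition. *)
Definition piecewise_causal t0 t1 f (a b : R) (s : seq R) beta : Prop :=
  [/\ a < b,
      itv_partition a b s,
      forall x, `[a, b]%classic x -> spacetime t0 t1 (beta x) &
      forall i, (i < size s)%N ->
        future_causal_curve f (nth b (a :: s) i) (nth b (a :: s) i.+1) beta \/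
        past_causal_curve f (nth b (a :: s) i) (nth b (a :: s) i.+1) beta].

Definition null_length (tau : R * S -> R) (a b : R) (s : seq R) beta : R :=
  variation a b (tau \o beta) s.

Definition null_distance t0 t1 f (tau : R * S -> R) (p q : R * S) : \bar R :=
  ereal_inf [set l : \bar R | exists a b s beta,
    [/\ piecewise_causal t0 t1 f a b s beta, beta a = p, beta b = q &
        l = (null_length tau a b s beta)%:E]].

Definition conformal_time t0 f (p : R * S) : R :=
  \int[lebesgue_measure]_(r in `[t0, p.1]) (f r)^-1.

End WarpedProduct.

(* Main.v *)
(* Since [foo <= f j], causal curves for [f j] are causal for [foo], which gives
   one inequality between the null distances. For the other, let a chain of
   causal curves for [foo] join [p] to [q] with null length [l]. As [tau] is the
   conformal time of [foo], its projection to Sigma has length at most [l], and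
   [|tau q - tau p| <= l]. Follow this projection with curves that are causal
   for [f j]: first climb monotonically from the level of [p] to that of [q]. On
   the way one can cover the spatial length [\int 1 / f j], which by L^1
   convergence is nearly [|tau q - tau p|], at the cost [|tau q - tau p|]. The
   rest, of length about [l - |tau q - tau p|], is covered by zigzags along null
   curves near a level close to that of [q] at which [f j] is nearly [foo]; such
   a level exists by L^1 convergence, and there a zigzag costs little more than
   its spatial length. The total is [l] up to an error that is uniform because the
   distances for [foo] are bounded, Sigma being compact and connected. *)

Require Import Defs.
From mathcomp Require Import all_boot all_order all_algebra.
From mathcomp Require Import all_classical all_reals all_analysis.
From mathcomp Require Import ring lra.
Import Order.TTheory GRing.Theory Num.Theory.
Import numFieldNormedType.Exports.
Local Open Scope classical_set_scope.
Local Open Scope ring_scope.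
Set Implicit Arguments.
Unset Strict Implicit.
Unset Printing Implicit Defensive.

(** * Continuously differentiable maps are differentiable *)

(** The factors are merely continuous, so a curve reparametrized through the integral of [1 / f]
    need not be smooth. Only affine changes of the time coordinate are made, on blocks so short that
    the factor is constant up to [1 + e]; these errors disappear as [e] is chosen small at the end.
    Length in Sigma is therefore measured by a width: the time increment of a curve causal for
    [-dt^2 + sigma], which bounds the length of its projection. By the intermediate value theorem
    such a curve can be cut at any prescribed width, and width may be left unspent, so a path is
    distributed exactly over blocks and zigzags and no arc length is computed. Two further
    obstacles: [smooth_on] speaks of directional derivatives while the change rule of the metric
    involves [jacobian], so C^1 maps must be shown differentiable; and a causal curve is never
    constant, so the distance from a point to itself requires short loops. *)

Section AffinePrecomposition.
Context (R : realType) (V' V W : normedModType R).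
Variables (h : V -> W) (phi L : V' -> V).
Hypothesis phiE : forall (k : R) w x, phi (k *: w + x) = k *: L w + phi x.

(** The difference quotients of [h \o phi] along [w] and of [h] along [L w] are the same function of
    [k], so the derivability statements and the derivatives coincide whatever [h] is. *)
Let growth_comp_affine x w :
  (fun k : R => k^-1 *: (((h \o phi) \o shift x) (k *: w) - (h \o phi) x)) =
  (fun k : R => k^-1 *: ((h \o shift (phi x)) (k *: L w) - h (phi x))).
Proof. by apply/funext => k /=; rewrite phiE. Qed.

Lemma derivable_comp_affine x w :
  derivable (h \o phi) x w = derivable h (phi x) (L w).
Proof. by rewrite /derivable growth_comp_affine. Qed.

Lemma derive_comp_affine x w : 'D_w (h \o phi) x = 'D_(L w) h (phi x).
Proof. by rewrite /derive growth_comp_affine. Qed.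

End AffinePrecomposition.

Section LineDerivatives.
Context (R : realType) (V W : normedModType R).
Implicit Types (h : V -> W) (a v : V) (s c : R).

Definition line a v s : V := s *: v + a.

Lemma lineE a v k (w x : R) :
  line a v (k *: w + x) = k *: (w *: v) + line a v x.
Proof. by rewrite /line scalerDl -addrA scalerA. Qed.

Lemma derivable_line h a v s : derivable h (line a v s) v ->
  derivable (h \o line a v) s 1.
Proof. by rewrite (derivable_comp_affine _ (lineE a v)) scale1r. Qed.

Lemma derive_line h a v s : 'D_1 (h \o line a v) s = 'D_v h (line a v s).
Proof. by rewrite (derive_comp_affine _ (lineE a v)) scale1r. Qed.

(** On the line through [a] this is a statement in one real variable, where derivable means
    differentiable and the differential is linear. *)
Lemma derive_scale_direction h a v c : derivable h a v ->
  'D_(c *: v) h a = c *: 'D_v h a.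
Proof.
move=> dh; have l0 : line a v 0 = a by rewrite /line scale0r add0r.
have /derivable1_diffP df : derivable (h \o line a v) 0 1.
  by apply: derivable_line; rewrite l0.
have := derive_comp_affine h (lineE a v) 0 c; rewrite l0 => <-.
rewrite deriveE//.
have -> : c = c *: (1 : R) by rewrite [_ *: _]mulr1.
by rewrite linearZ -deriveE// derive_line l0 [_ *: (1 : R)]mulr1.
Qed.

End LineDerivatives.

Section MeanValue.
Context (R : realType) (V : normedModType R) (m : nat).
Implicit Types (h : V -> 'rV[R]_m) (a v : V).

(** The scalar mean value theorem is applied to each entry. The intermediate point depends on the
    entry, but the bound [e] does not, and the norm is the maximum of the entries. *)
Lemma row_mean_value h a v (L : 'rV[R]_m) (e : R) :
  0 <= e ->
  (forall s : R, 0 <= s <= 1 -> derivable h (line a v s) v) ->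
  (forall s : R, 0 <= s <= 1 -> `|'D_v h (line a v s) - L| <= e) ->
  `|h (v + a) - h a - L| <= e.
Proof.
move=> e0 dh bh.
rewrite [leLHS]/Num.Def.normr/= mx_normrE (bigmax_le _ e0)//= => -[i j] _ /=.
rewrite ord1 {i} !mxE.
pose g (s : R) : R := h (line a v s) ord0 j.
have dg (s : R) : 0 <= s <= 1 ->
    is_derive s (1 : R) g ('D_v h (line a v s) ord0 j).
  move=> /dh/derivable_line d; rewrite -derive_line (derive_mx d) mxE.
  by split=> //; exact: ((derivable_mxP _ _ _).1 d ord0 j).
have [||c c01] := @MVT R g (fun s => 'D_v h (line a v s) ord0 j) 0 1 ltr01.
- by move=> x; rewrite in_itv /= => /andP[x0 x1]; apply: dg; rewrite !ltW.
- apply: derivable_within_continuous => x; rewrite in_itv/= => /dg dx.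
  exact: ex_derive.
rewrite /g /line scale1r scale0r add0r subr0 mulr1 => ->.
have {}c01 : 0 <= c <= 1.
  by move: c01; rewrite in_itv/= => /andP[c0 c1]; rewrite !ltW.
apply: le_trans (bh c c01).
rewrite [leRHS]/Num.Def.normr/= mx_normrE.
by apply: le_trans (le_bigmax _ _ (ord0, j)); rewrite /= !mxE.
Qed.

End MeanValue.

Section ContinuouslyDifferentiable.
Context (R : realType) (n m : nat) (U : set 'rV[R]_n).
Variable h : 'rV[R]_n -> 'rV[R]_m.
Hypothesis U_open : open U.
Hypothesis h_derivable : forall x v, U x -> derivable h x v.
Hypothesis h_C1 : forall x v, U x -> {for x, continuous ('D_v h)}.

(** The increment along [u + v] is the increment along [u] followed by the one along [v] from the
    moved base point [t *: u + a]. Continuity of ['D_v h] and the mean value inequality show that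
    moving the base point is harmless in the limit. *)
Lemma C1_deriveD a u v : U a -> 'D_(u + v) h a = 'D_u h a + 'D_v h a.
Proof.
move=> Ua; apply/cvg_lim => //=.
have Uball : \forall x \near a, U x by exact: open_nbhs_nbhs.
pose q1 (t : R) := t^-1 *: (h (t *: v + (t *: u + a)) - h (t *: u + a)).
pose q2 (t : R) := t^-1 *: (h (t *: u + a) - h a).
have -> : (fun t => t^-1 *: (h (t *: (u + v) + a) - h a)) = q2 \+ q1.
  apply/funext => t /=; rewrite /q1 /q2 -scalerDr; congr (_ *: _).
  by rewrite [RHS]addrC subrKA scalerDr [t *: u + t *: v]addrC addrA.
apply: cvgD; first exact: h_derivable.
apply/cvgrPdist_le => e e0.
have : \forall x \near a, `|'D_v h a - 'D_v h x| <= e.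
  by move/cvgrPdist_le: (h_C1 (v := v) Ua) => /(_ e e0).
move=> /(filterI Uball) /nbhs_normP[r /= r0 rP].
near=> t.
have t0 : t != 0 by near: t; exact: nbhs_dnbhs_neq.
have inball (s : R) : 0 <= s <= 1 -> ball_ Num.norm a r (line (t *: u + a) (t *: v) s).
  move=> /andP[s0 s1]; rewrite /ball_/= /line distrC addrA addrK.
  rewrite (le_lt_trans (ler_normD _ _))// !normrZ (ger0_norm s0).
  rewrite (@le_lt_trans _ _ (`|t| * (`|v| + `|u|)))//.
    by rewrite mulrDr lerD2r -[leRHS]mul1r ler_wpM2r.
  (* The summand [1] keeps the divisor positive when [u] and [v] vanish. *)
  rewrite (@le_lt_trans _ _ (`|t| * (`|v| + `|u| + 1)))//.
    by rewrite ler_wpM2l// lerDl.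
  rewrite -ltr_pdivlMr ?ltr_wpDl ?addr_ge0//.
  near: t; apply: dnbhs0_lt; rewrite divr_gt0// ltr_wpDl ?addr_ge0//.
have H : `|h (t *: v + (t *: u + a)) - h (t *: u + a) - t *: 'D_v h a| <= `|t| * e.
  apply: row_mean_value; first by rewrite mulr_ge0// ltW.
    by move=> s /inball /rP[Us _]; exact: h_derivable.
  move=> s /inball /rP[Us ds].
  rewrite derive_scale_direction; last exact: h_derivable.
  by rewrite -scalerBr normrZ distrC ler_wpM2l.
rewrite -(ler_pM2l (x := `|t|)) ?normr_gt0// (le_trans _ H)//.
rewrite -normrZ scalerBr /q1 scalerA divff// scale1r distrC.
exact: lexx.
Unshelve. all: by end_near. Qed.

Lemma C1_deriveE a v : U a -> 'D_v h a = \sum_(i < n) v ord0 i *: 'D_(delta_mx ord0 i) h a.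
Proof.
move=> Ua; rewrite [v in LHS]row_sum_delta.
elim/big_ind2 : _ => [|x x' y y' <- <-|i _]; first exact: derive0.
  exact: C1_deriveD.
by rewrite derive_scale_direction//; exact: h_derivable.
Qed.

Lemma C1_differentiable a : U a -> differentiable h a.
Proof.
move=> Ua.
pose J := \matrix_(i < n) 'D_(delta_mx ord0 i) h a.
pose df : {linear 'rV[R]_n -> 'rV[R]_m} := mulmxr J.
have dfE v : df v = 'D_v h a.
  rewrite C1_deriveE//= mulmx_sum_row; apply: eq_bigr => i _.
  by rewrite rowK.
have df_cont : continuous df.
  have -> : df = (fun v => \sum_(i < n) v ord0 i *: row i J) :> (_ -> _).
    by apply/funext => v; rewrite /= mulmx_sum_row.
  apply: continuous_big => [|i _ v]; first exact: add_continuous.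
    exact: (@cvgZr_tmp R _ _ (nbhs v) _ (fun v : 'rV[R]_n => v ord0 i) _ (row i J) (@coord_continuous R 1 n ord0 i v)).
have coord_le (v : 'rV[R]_n) i : `|v ord0 i| <= `|v|.
  rewrite [leRHS]/Num.Def.normr/= mx_normrE.
  exact: (le_trans _ (le_bigmax _ _ (ord0, i))).
(* The differential is chosen among the linear maps with these two properties, so exhibiting [df] is
   enough. *)
apply/diffP; apply: (@getPex _ (fun df : {linear 'rV[R]_n -> 'rV[R]_m} =>
  continuous df /\ forall y, h y = h (lim (nbhs a)) + df (y - lim (nbhs a))
    +o_(y \near a) (y - lim (nbhs a)))).
exists df; split => //.
suff E : h = (fun y => h (lim (nbhs a)) + df (y - lim (nbhs a)))
    +o_ (nbhs a) (fun y => y - lim (nbhs a)).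
  by move: E; rewrite funeqE; apply.
apply/eqaddoP => _/posnumP[e]; rewrite lim_id//.
(* Each of the [n] partial derivatives may contribute an error [e']; the denominator is [n.+1]
   because [n] may be [0]. *)
pose e' := e%:num / n.+1%:R.
have e'0 : 0 < e' by rewrite divr_gt0.
have : \forall x \near a, U x by exact: open_nbhs_nbhs.
have : \forall x \near a,
    forall i, `|'D_(delta_mx ord0 i) h a - 'D_(delta_mx ord0 i) h x| <= e'.
  apply: (@filter_forall _ _ (fun i x =>
    `|'D_(delta_mx ord0 i) h a - 'D_(delta_mx ord0 i) h x| <= e') _ (nbhs_filter a)) => i.
  by move/cvgrPdist_le: (h_C1 (v := delta_mx ord0 i) Ua) => /(_ e' e'0).
move=> /[swap] /filterI /[apply].
move=> /nbhs_normP[r /= r0 rP].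
have : \forall y \near a, `|a - y| < r by apply/nbhs_normP; exists r.
apply: filterS => y; rewrite distrC => vr.
set v := y - a in vr.
have inball (s : R) : 0 <= s <= 1 -> (ball_ Num.norm a r) (line a v s).
  move=> /andP[s0 s1]; rewrite /ball_/= /line distrC addrK normrZ ger0_norm//.
  by rewrite (le_lt_trans _ vr)// -[leRHS]mul1r ler_wpM2r.
rewrite -[leLHS]/(`|h y - (h a + df v)|) -[leRHS]/(_ * `|v|) opprD addrA.
rewrite -[y in h y](subrK a) -/v.
apply: row_mean_value; first by rewrite mulr_ge0.
  by move=> s /inball/rP[Us _]; exact: h_derivable.
move=> s /inball/rP[Us ds]; rewrite dfE !C1_deriveE// -sumrB.
rewrite (le_trans (ler_norm_sum _ _ _))//.
rewrite (@le_trans _ _ (\sum_(i < n) `|v| * e'))//.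
  apply: ler_sum => i _; rewrite -scalerBr normrZ ler_pM// distrC; exact: ds.
rewrite sumr_const card_ord -mulrnAr mulrC ler_wpM2r// /e'.
rewrite -mulr_natr -mulrA ler_piMr// mulrC ler_pdivrMr// mul1r ler_nat.
exact: leqnSn.
Qed.

End ContinuouslyDifferentiable.

(** * Smooth functions and affine maps *)

Section SmoothFunctions.
Context (R : realType).

Lemma smooth_on_cst (V W : normedModType R) (U : set V) (w : W) :
  smooth_on U (fun _ : V => w).
Proof.
move=> vs x Ux /=.
have [w' ->] : exists w' : W, foldr (fun v h => 'D_v h) (fun _ : V => w) vs = cst w'.
  elim: vs => [|v vs [w' IH]]; first by exists w.
  by exists 0; apply/funext => y; rewrite /= IH derive_cst.
by split=> [|v]; [exact: cst_continuous|exact: derivable_cst].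
Qed.

Lemma smooth_on_id (U : set R) : smooth_on U (fun s : R => s).
Proof.
move=> vs x Ux; case/lastP: vs => [/=|vs v].
  by split=> [|v]; [exact: cvg_id|exact: derivable_id].
have -> : foldr (fun v (h : R -> R) => 'D_v h) (fun s : R => s) (rcons vs v) =
    foldr (fun v h => 'D_v h) (fun _ : R => v) vs.
  rewrite -cats1 foldr_cat /=; congr foldr.
  by apply/funext => y; rewrite derive_id.
exact: (@smooth_on_cst _ _ U).
Qed.

Lemma smooth_on_comp_affine (V' V W : normedModType R) (U' : set V') (U : set V)
    (phi L : V' -> V) (h : V -> W) :
  (forall (k : R) w x, phi (k *: w + x) = k *: L w + phi x) ->
  continuous phi -> (forall x, U' x -> U (phi x)) ->
  smooth_on U h -> smooth_on U' (h \o phi).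
Proof.
move=> phiE phi_cont phiU sh vs x U'x.
have -> : foldr (fun v h => 'D_v h) (h \o phi) vs =
    foldr (fun v h => 'D_v h) h (map L vs) \o phi.
  elim: vs => //= v vs ->; apply/funext => y.
  by rewrite (derive_comp_affine _ phiE).
have [ch dh] := sh (map L vs) _ (phiU _ U'x); split=> [|v].
  by apply: continuous_comp; [exact: phi_cont|exact: ch].
by rewrite (derivable_comp_affine _ phiE).
Qed.

(** The constant [c] survives only in the derivative of order zero. The formula for iterated
    derivatives is known on [U] alone; openness of [U] allows it to be differentiated again. *)
Lemma smooth_on_affine (V : normedModType R) (U : set V) (k c : R) (h : V -> R) :
  open U -> smooth_on U h -> smooth_on U (fun x => c + k * h x).
Proof.
move=> oU sh.
have E vs x : U x -> foldr (fun v h => 'D_v h) (fun x => c + k * h x) vs x =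
    (if vs is [::] then c else 0) + k * foldr (fun v h => 'D_v h) h vs x.
  elim: vs x => //= v vs IH x Ux.
  have [_ dh] := sh vs x Ux.
  set c' := if vs is [::] then c else 0 in IH.
  set g := foldr _ h vs in IH dh *.
  rewrite (@near_eq_derive _ _ _ _ (fun x => c' + k * g x)); last first.
    near=> y; apply: IH; near: y; exact: open_nbhs_nbhs.
  rewrite deriveD//; last exact: derivableZ.
  by rewrite derive_cst deriveZ.
move=> vs x Ux /=.
have Evs := E vs; set c' := if vs is [::] then c else 0 in Evs.
pose g := foldr (fun v (h : V -> R) => 'D_v h) h vs.
have [cg dg] : {for x, continuous g} /\ forall v, derivable g x v := sh vs x Ux.
pose F := foldr (fun v (h : V -> R) => 'D_v h) (fun x => c + k * h x) vs.
change ({for x, continuous F} /\ forall v, derivable F x v).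
have near_E : \forall y \near x, c' + k * g y =
F y.
  near=> y; apply/esym/Evs; near: y; exact: open_nbhs_nbhs.
split=> [|v].
  have Fx : F x = c' + k * g x by exact: Evs.
  suff : F y @[y --> x] --> F x by [].
  rewrite Fx.
  apply: cvg_trans (near_eq_cvg near_E) _.
  by apply: cvgD; [exact: cvg_cst|apply: cvgM; [exact: cvg_cst|exact: cg]].
apply: near_eq_derivable near_E _; apply: derivableD => //.
by apply: derivableZ; exact: dg.
Unshelve. all: by end_near. Qed.

End SmoothFunctions.

(** * Curves in the warped product *)

Section Arcs.
Context (R : realType) (n : nat) (S : topologicalType).
Context (X : smoothManifold R n S) (sigma : riemannianMetric X).

Definition speed2 (c : chart R n S) (x : S) (v : 'rV[R]_n) : R :=
  (v *m rmetric sigma c x *m v^T) 0 0.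

Lemma speed2_ge0 c x v : atlas X c -> cdom c x -> 0 <= speed2 c x v.
Proof.
move=> Xc cx; have [->|v0] := eqVneq v 0; last exact/ltW/rmetric_pos.
by rewrite /speed2 !mul0mx mxE.
Qed.

Lemma warped_metric_sq f c p v :
  warped_metric sigma f c p v v = f p.1 ^+ 2 * speed2 c p.2 v.2 - v.1 ^+ 2.
Proof. by rewrite /warped_metric addrC expr2. Qed.

Lemma warped_metric_partial_t f c p v :
  warped_metric sigma f c p v (partial_t R n) = - v.1.
Proof. by rewrite /warped_metric /= mulr1 trmx0 mulmx0 mxE mulr0 addr0. Qed.

Lemma future_causalE f c p v : future_causal sigma f c p v <->
  0 < v.1 /\ f p.1 ^+ 2 * speed2 c p.2 v.2 <= v.1 ^+ 2.
Proof.
rewrite /future_causal /causal warped_metric_partial_t warped_metric_sq.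
rewrite oppr_lt0 subr_le0; split=> [[[_ ?] ?] //|[v0 ?]]; do !split => //.
by apply/eqP => v00; rewrite v00 ltxx in v0.
Qed.

Lemma past_causalE f c p v : past_causal sigma f c p v <->
  v.1 < 0 /\ f p.1 ^+ 2 * speed2 c p.2 v.2 <= v.1 ^+ 2.
Proof.
rewrite /past_causal /causal warped_metric_partial_t warped_metric_sq.
rewrite oppr_gt0 subr_le0; split=> [[[_ ?] ?] //|[v0 ?]]; do !split => //.
by apply/eqP => v00; rewrite v00 ltxx in v0.
Qed.

Lemma smooth_curve_derivable U (alpha : R -> R * S) s : open U ->
  smooth_curve_on X U alpha -> U s -> derivable (fst \o alpha : R -> R) s 1.
Proof. by move=> oU [sa _ _] Us; have [_] := sa [::] s Us; apply. Qed.

Lemma smooth_curve_affine_time U (alpha : R -> R * S) k d : open U ->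
  smooth_curve_on X U alpha ->
  smooth_curve_on X U (fun s => (d + k * (alpha s).1, (alpha s).2)).
Proof. 
move=> oU [sa ca ma]; split; [|exact: ca|exact: ma].
exact: (@smooth_on_affine R _ U k d (fst \o alpha) oU sa).
Qed.

Lemma velocity_affine_time U (alpha : R -> R * S) (c : chart R n S) k d s : open U ->
  smooth_curve_on X U alpha -> U s ->
  velocity c (fun s => (d + k * (alpha s).1, (alpha s).2)) s =
  (k * (velocity c alpha s).1, (velocity c alpha s).2).
Proof.
move=> oU sa Us; rewrite /velocity; congr pair.
have da := smooth_curve_derivable oU sa Us.
rewrite !derive1E.
have -> : fst \o (fun s => (d + k * (alpha s).1, (alpha s).2)) =
    cst d + k *: (fst \o alpha : R -> R) by [].
rewrite deriveD; [|exact: derivable_cst|exact: derivableZ].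
by rewrite derive_cst add0r deriveZ.
Qed.

Lemma smooth_curve_shift U (alpha : R -> R * S) d : open U ->
  smooth_curve_on X U alpha ->
  open (shift d @^-1` U) /\ smooth_curve_on X (shift d @^-1` U) (alpha \o shift d).
Proof.
move=> oU [sa ca ma].
have sc : continuous (shift d : R -> R).
  by move=> x; apply: cvgD; [exact: cvg_id|exact: cvg_cst].
have sE (k : R) (w x : R) : shift d (k *: w + x) = k *: id w + shift d x.
  by rewrite /= addrA.
split; first by apply: open_comp => // x _; exact: sc.
split.
- exact: (@smooth_on_comp_affine R R R R _ U _ _ _ sE sc (fun x Ux => Ux) sa).
- move=> s Us.
  exact: (@continuous_comp _ _ _ (shift d) (snd \o alpha) s (sc s) (ca _ Us)).
- move=> c Xc.
  exact: (@smooth_on_comp_affine R R R _ _ _ _ _ _ sE sc (fun x Ux => Ux) (ma c Xc)).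
Qed.

Lemma velocity_shift (alpha : R -> R * S) (c : chart R n S) d s :
  velocity c (alpha \o shift d) s = velocity c alpha (s + d).
Proof.
have sE (k : R) (w x : R) : shift d (k *: w + x) = k *: id w + shift d x.
  by rewrite /= addrA.
rewrite /velocity !derive1E; congr pair.
  exact: (derive_comp_affine (fst \o alpha : R -> R) sE).
exact: (derive_comp_affine (fun r => cmap c (alpha r).2) sE).
Qed.

End Arcs.

(** * Spatial links *)

Section Links.
Context (R : realType) (n : nat) (S : topologicalType).
Context (X : smoothManifold R n S) (sigma : riemannianMetric X).
Implicit Types (x y z : S) (w u k : R) (alpha : R -> R * S).

Lemma time_increasing a b (U : set R) alpha : open U -> `[a, b] `<=` U ->
  smooth_curve_on X U alpha ->
  (forall s (c : chart R n S), `[a, b]%classic s -> atlas X c ->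
     cdom c (alpha s).2 -> 0 < (velocity c alpha s).1) ->
  forall s s', a <= s -> s < s' -> s' <= b -> (alpha s).1 < (alpha s').1.
Proof.
move=> oU abU sa v0 s s' sa' ss' sb'.
have d0 r : r \in `]a, b[ -> 0 < derive1 (fst \o alpha : R -> R) r.
  move=> rab; have [c Xc rc] := atlas_cover X (alpha r).2.
  by apply: (v0 r c) => //; apply: subset_itv_oo_cc rab.
apply: (gtr0_derive1_lt_cc (f := fst \o alpha) (a := a) (b := b)) => //.
- move=> r rab; apply: (smooth_curve_derivable oU sa); apply: abU.
  exact: subset_itv_oo_cc rab.
- apply: derivable_within_continuous => r rab.
  by apply: (smooth_curve_derivable oU sa); exact: abU.
- by rewrite in_itv/= sa' (le_trans (ltW ss')).
- by rewrite in_itv/= sb' (le_trans sa' (ltW ss')).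
Qed.

(** Strict bounds on [t] make [c] interior, so that a curve cut at [c] leaves two nondegenerate
    pieces. *)
Lemma time_ivt a b (U : set R) alpha t : a < b -> open U -> `[a, b] `<=` U ->
  smooth_curve_on X U alpha ->
  Num.min (alpha a).1 (alpha b).1 < t < Num.max (alpha a).1 (alpha b).1 ->
  exists c, [/\ a < c, c < b & (alpha c).1 = t].
Proof.
move=> ab oU abU sa tab.
have [c cab cE] : exists2 c, c \in `[a, b] & (fst \o alpha : R -> R) c = t.
  apply: IVT; first exact: ltW.
    apply: derivable_within_continuous => r rab.
    by apply: (smooth_curve_derivable oU sa); exact: abU.
  by case/andP: tab => ? ?; rewrite /= !ltW.
rewrite /= in cE; move: cab tab; rewrite in_itv/= -cE gt_min lt_max.
move=> /andP[ac cb] btw; exists c; rewrite !lt_neqAle ac cb !andbT; split=> //.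
  by apply/eqP => ca; move: btw; rewrite -ca !ltxx /= => /andP[/lt_trans h /h]; rewrite ltxx.
by apply/eqP => ca; move: btw; rewrite ca !ltxx !orbF /= => /andP[/lt_trans h /h]; rewrite ltxx.
Qed.

(* A future causal curve of the product metric [-dt^2 + sigma] whose spatial
   part runs from [x] to [y] and whose time coordinate grows by [w]. *)
Definition link x y w : Prop := exists a b U alpha,
  [/\ a < b, open U, `[a, b] `<=` U, smooth_curve_on X U alpha &
   [/\ (alpha a).2 = x, (alpha b).2 = y, (alpha b).1 - (alpha a).1 = w &
    forall s c, `[a, b]%classic s -> atlas X c -> cdom c (alpha s).2 ->
      0 < (velocity c alpha s).1 /\
      speed2 sigma c (alpha s).2 (velocity c alpha s).2
        <= (velocity c alpha s).1 ^+ 2]].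

Lemma link_gt0 x y w : link x y w -> 0 < w.
Proof.
move=> [a [b [U [alpha [ab oU abU sa [_ _ <- v]]]]]]; rewrite subr_gt0.
apply: (time_increasing oU abU sa) => // s c abs Xc cs.
by have [] := v s c abs Xc cs.
Qed.

(** Only the time coordinate is rescaled, so a curve causal for another metric becomes a link once a
    constant multiple of its time speed dominates its spatial speed. A negative [k] serves past
    causal curves. *)
Lemma link_of_curve a b (U : set R) alpha k : a < b -> open U ->
  `[a, b] `<=` U -> smooth_curve_on X U alpha ->
  (forall s c, `[a, b]%classic s -> atlas X c -> cdom c (alpha s).2 ->
      0 < k * (velocity c alpha s).1 /\
      speed2 sigma c (alpha s).2 (velocity c alpha s).2
        <= (k * (velocity c alpha s).1) ^+ 2) ->
  link (alpha a).2 (alpha b).2 (k * ((alpha b).1 - (alpha a).1)).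
Proof.
move=> ab oU abU sa v.
exists a, b, U, (fun s => (0 + k * (alpha s).1, (alpha s).2)).
split; [exact: ab|exact: oU|exact: abU|exact: smooth_curve_affine_time|].
split; [by []|by []|by rewrite /= !add0r mulrBr|].
move=> s c abs Xc cs; rewrite (velocity_affine_time _ _ _ oU sa (abU _ abs)).
exact: v.
Qed.

Lemma link_split x y w u : link x y w -> 0 < u < w ->
  exists z, link x z u /\ link z y (w - u).
Proof.
move=> [a [b [U [alpha [ab oU abU sa [<- <- wE v]]]]]] /andP[u0 uw].
have [c [ac cb cE]] : exists c, [/\ a < c, c < b & (alpha c).1 = (alpha a).1 + u].
  apply: (time_ivt ab oU abU sa).
  have ub : (alpha a).1 + u < (alpha b).1 by rewrite -ltrBrDl wE.
  by rewrite gt_min lt_max ltrDl u0 ub orbT.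
exists (alpha c).2; split.
  exists a, c, U, alpha; split; [exact: ac|exact: oU| |exact: sa|].
    by apply: subset_trans abU; apply: subset_itvl; rewrite bnd_simp ltW.
  split; [by []|by []| |move=> s d acs]; first by rewrite cE addrC addKr.
  by apply: v; apply: subset_itvl acs; rewrite bnd_simp ltW.
exists c, b, U, alpha; split; [exact: cb|exact: oU| |exact: sa|].
  by apply: subset_trans abU; apply: subset_itvr; rewrite bnd_simp ltW.
split; [by []|by []| |move=> s d acs]; first by rewrite cE -wE opprD addrA.
by apply: v; apply: subset_itvr acs; rewrite bnd_simp ltW.
Qed.

(** A vertical line: width need not be spent on spatial motion. This is what allows widths to be
    enlarged in [links_widen]. *)
Lemma link_refl x w : 0 < w -> link x x w.
Proof.
move=> w0; exists 0, w, setT, (fun s => (s, x)); split; [exact: w0|exact: openT|by []| |].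
  split=> [|s _|c Xc]; first exact: smooth_on_id.
    exact: (@cst_continuous R S x).
  exact: (@smooth_on_cst R R _ _ (cmap c x)).
split; [by []|by []|by rewrite /= subr0|].
move=> s c _ Xc cx; rewrite /velocity/= /comp /= derive1_id derive1_cst.
by rewrite ltr01 /speed2 !mul0mx mxE expr1n ler01.
Qed.

(** The counterpart of a piecewise smooth path of length at most the last index. Nothing is required
    at the joints, and width [0] is available although every link has positive width. *)
Inductive links : S -> S -> R -> Prop :=
| links_nil x : links x x 0
| links_cons x y z w w' : link x y w -> links y z w' -> links x z (w + w').

Lemma links1 x y w : link x y w -> links x y w.
Proof. by move=> l; rewrite -[w]addr0; apply: links_cons l _; exact: links_nil. Qed.

Lemma links_ge0 x y w : links x y w -> 0 <= w.
Proof. by elim=> // ? ? ? ? ? /link_gt0 ? _ ?; rewrite addr_ge0// ltW. Qed.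

Lemma links_trans x y z w w' : links x y w -> links y z w' -> links x z (w + w').
Proof.
move=> xy; elim: xy z w' => [*|{}x {}y a {}w v l _ IH z w' /IH]; first by rewrite add0r.
by rewrite -addrA; exact: links_cons.
Qed.

Lemma links_widen x y w w' : links x y w -> w <= w' -> links x y w'.
Proof.
move=> l; rewrite le_eqVlt => /predU1P[<- //|ww'].
rewrite -(subrK w w') addrC; apply: links_trans l (links1 (link_refl _ _)).
by rewrite subr_gt0.
Qed.

Lemma links_split x y w u : links x y w -> 0 <= u <= w ->
  exists z, links x z u /\ links z y (w - u).
Proof.
move=> l; elim: l u => [{}x u|{}x {}y z {}w w' l ls IH u /andP[u0 uw]].
  rewrite -eq_le => /eqP <-; exists x; rewrite subr0; split; exact: links_nil.
have [wu|uw'] := leP w u.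
  have [|z' [l1 l2]] := IH (u - w).
    by rewrite subr_ge0 wu lerBlDl.
  exists z'; split; first by rewrite -(subrK w u) addrC; exact: links_cons l l1.
  by move: l2; rewrite opprB addrA [w' + w]addrC.
move: u0; rewrite le_eqVlt => /predU1P[<-|u0].
  exists x; split; first exact: links_nil.
  by rewrite subr0; exact: links_cons l ls.
have [|z' [l1 l2]] := link_split l (u := u); first by rewrite u0.
exists z'; split; first exact: links1.
by rewrite addrAC; exact: links_cons l2 ls.
Qed.

End Links.

(** * Straight lines in charts *)

Section LocalLinks.
Context (R : realType) (n : nat) (S : topologicalType).
Context (X : smoothManifold R n S) (sigma : riemannianMetric X).

Lemma mx_entry_le (m k : nat) (A : 'M[R]_(m, k)) i j : `|A i j| <= `|A|.
Proof.
rewrite [leRHS]/Num.Def.normr/= mx_normrE.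
exact: (le_trans _ (le_bigmax _ _ (i, j))).
Qed.

Lemma quadratic_form_le (A : 'M[R]_n) (v : 'rV[R]_n) (G r : R) :
  (forall i j, `|A i j| <= G) -> `|v| <= r ->
  (v *m A *m v^T) 0 0 <= n%:R * (n%:R * (r * G * r)).
Proof.
move=> AG vr; have r0 : 0 <= r by exact: le_trans vr.
rewrite mxE (le_trans (ler_norm _))// (le_trans (ler_norm_sum _ _ _))//.
rewrite -[n in n%:R * _]card_ord -sumr_const mulr_suml; apply: ler_sum => j _.
rewrite mul1r normrM !mxE mulrA.
apply: ler_pM => //; last by rewrite (le_trans _ vr)// mx_entry_le.
rewrite (le_trans (ler_norm_sum _ _ _))//.
rewrite -[n in n%:R * _]card_ord -sumr_const mulr_suml; apply: ler_sum => i _.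
by rewrite mul1r normrM ler_pM// (le_trans _ vr)// mx_entry_le.
Qed.

Lemma open_transition_domain (c c' : chart R n S) :
  open (cmap c @` (cdom c `&` cdom c')).
Proof.
rewrite openE => _ [x [cx c'x] <-]; rewrite /interior.
have Oy : (cmap c @` cdom c) (cmap c x) by exists x.
have near_O : \forall y \near cmap c x, (cmap c @` cdom c) y.
  by apply: open_nbhs_nbhs; split=> //; exact: cimg_open.
have near_c' : \forall y \near cmap c x, cdom c' (cinv c y).
  apply: (cinv_continuous Oy); rewrite cmapK//.
  by apply: open_nbhs_nbhs; split=> //; exact: cdom_open.
near=> y.
have [z cz zy] : (cmap c @` cdom c) y by near: y.
exists z => //; split=> //; rewrite -(cmapK cz) zy.
by near: y.
Unshelve. all: by end_near. Qed.

(** The velocity of a curve is a directional derivative, whereas [rmetric_change] is stated with the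
    Jacobian; differentiability of C^1 maps connects the two. *)
Lemma transition_derive (c c' : chart R n S) y v : atlas X c -> atlas X c' ->
  (cmap c @` (cdom c `&` cdom c')) y ->
  'D_v (cmap c' \o cinv c) y = v *m jacobian (cmap c' \o cinv c) y.
Proof.
move=> Xc Xc' cy; have sm := atlas_smooth Xc Xc'.
apply/deriveEjacobian/(@C1_differentiable R n n
  (cmap c @` (cdom c `&` cdom c'))) => // [|x u cx|x u cx].
- exact: open_transition_domain.
- by have [_] := sm [::] x cx; apply.
- by have [] := sm [:: u] x cx.
Qed.

(** The segment between the two images stays in the ball, where the Gram matrix is bounded by [G];
    run through with a large constant time speed, it is causal. Causality is checked in the chart
    [c] and carried to the other charts by the change rule. The width depends on the ball only. *)
Lemma straight_link (c : chart R n S) (y : 'rV[R]_n) (r G : R) : atlas X c ->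
  (forall p, `|y - p| < r -> (cmap c @` cdom c) p /\
     forall i j, `|rmetric sigma c (cinv c p) i j| <= G) ->
  exists w, forall x z, cdom c x -> cdom c z ->
    `|y - cmap c x| < r -> `|y - cmap c z| < r -> link sigma x z w.
Proof.
move=> Xc ball_y; pose B := n%:R * (n%:R * ((r + r) * G * (r + r))).
(* [B] bounds the squared spatial speed, and [1 <= K] gives [B <= K <= K ^+ 2]. *)
pose K := 1 + `|B|.
have K1 : 1 <= K by rewrite lerDl.
have K0 : 0 < K by exact: lt_le_trans K1.
exists K => x z cx cz xr zr.
pose p := cmap c x; pose v := cmap c z - p; pose l := line p v.
have vr : `|v| <= r + r.
  rewrite /v -(subrKA y) (le_trans (ler_normD _ _))//.
  by rewrite lerD// ltW// distrC.
have l_ball s : 0 <= s <= 1 -> `|y - l s| < r.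
  move=> /andP[s0 s1].
  have -> : y - l s = s *: (y - cmap c z) + (1 - s) *: (y - cmap c x).
    rewrite /l /line /v /p; apply/matrixP => i j; rewrite !mxE; ring.
  rewrite (le_lt_trans (ler_normD _ _))// !normrZ !ger0_norm ?subr_ge0//.
  move: s0; rewrite le_eqVlt => /predU1P[<-|s0].
    by rewrite mul0r add0r subr0 mul1r.
  have : s * `|y - cmap c z| < s * r by rewrite ltr_pM2l.
  have : (1 - s) * `|y - cmap c x| <= (1 - s) * r by rewrite ler_wpM2l ?subr_ge0// ltW.
  by lra.
have l_cont : continuous l.
  move=> s; apply: cvgD; last exact: cvg_cst.
  exact: (cvgZr_tmp (s := fun s : R => s) cvg_id).
pose U := l @^-1` [set q | `|y - q| < r].
have oU : open U.
  apply: open_comp; first by move=> s _; exact: l_cont.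
  have -> : [set q | `|y - q| < r] = ball y r by rewrite -ball_normE.
  exact: ball_open.
have U01 : `[0, 1] `<=` U by move=> s; rewrite /= in_itv/=; exact: l_ball.
have U_img s : U s -> (cmap c @` cdom c) (l s) by move=> /ball_y[].
have U_chart (c' : chart R n S) s : U s -> cdom c' (cinv c (l s)) ->
    (cmap c @` (cdom c `&` cdom c')) (l s).
  move=> /U_img[q cq ql] c's; exists q => //; split=> //.
  by rewrite -ql cmapK// in c's.
pose alpha (s : R) := (0 + K * s, cinv c (l s)).
have sa : smooth_curve_on X U alpha.
  split.
  - exact: (@smooth_on_affine R R U K 0 (fun s => s) oU (@smooth_on_id R U)).
  - move=> s Us; apply: (@continuous_comp _ _ _ l (cinv c) s (l_cont s)).
    exact/cinv_continuous/U_img.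
  - move=> c' Xc'; apply: (@smooth_on_comp_affine R R _ _ _
      (cmap c @` (cdom c `&` cdom c')) _ _ _ (lineE p v) l_cont _
      (atlas_smooth Xc Xc')) => s [Us c's].
    exact: U_chart.
exists 0, 1, U, alpha; split; [exact: ltr01|exact: oU|exact: U01|exact: sa|].
split.
- by rewrite /= /l /line scale0r add0r cmapK.
- by rewrite /= /l /line scale1r subrK cmapK.
- by rewrite /= mulr1 mulr0 !add0r subr0.
move=> s c' s01 Xc' c's; have Us := U01 s s01.
pose J := jacobian (cmap c' \o cinv c) (l s).
have velE : velocity c' alpha s = (K, v *m J).
  rewrite /velocity !derive1E; congr pair.
    have -> : fst \o alpha = cst 0 + K *: (id : R -> R) by [].
    rewrite deriveD; [|exact: derivable_cst|by apply: derivableZ; exact: derivable_id].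
    rewrite derive_cst add0r deriveZ; last exact: derivable_id.
    by rewrite derive_id [_ *: _]mulr1.
  rewrite -(transition_derive v Xc Xc' (U_chart c' s Us c's)).
  exact: derive_line.
rewrite velE /=; split=> //.
have [q [cq c'q] ql] := U_chart c' s Us c's.
have qE : cinv c (l s) = q by rewrite -ql cmapK.
have -> : speed2 sigma c' (cinv c (l s)) (v *m J) = speed2 sigma c (cinv c (l s)) v.
  rewrite /speed2 trmx_mul !mulmxA qE.
  have -> := rmetric_change sigma Xc Xc' cq c'q.
  by rewrite ql !mulmxA.
have [_ gG] := ball_y _ Us.
have h := quadratic_form_le gG vr.
apply: (le_trans h); rewrite -/B.
apply: (@le_trans _ _ K); first by rewrite (le_trans (ler_norm _))// lerDr.
by rewrite expr2 ler_peMl// ltW.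
Qed.

Lemma locally_linked (x0 : S) : exists w, exists2 U : set S, nbhs x0 U &
  forall x z, U x -> U z -> link sigma x z w.
Proof.
have [c Xc cx0] := atlas_cover X x0; pose y0 := cmap c x0.
pose G := `|rmetric sigma c x0| + 1.
have Oy0 : (cmap c @` cdom c) y0 by exists x0.
have near_O : \forall p \near y0, (cmap c @` cdom c) p.
  by apply: open_nbhs_nbhs; split=> //; exact: cimg_open.
have near_G : \forall p \near y0,
    forall ij, `|rmetric sigma c (cinv c p) ij.1 ij.2| <= G.
  apply: (@filter_forall _ _ (fun ij p =>
    `|rmetric sigma c (cinv c p) ij.1 ij.2| <= G) _ (nbhs_filter y0)) => -[i j] /=.
  have [gc _] := rmetric_smooth sigma i j Xc [::] Oy0.
  move/cvgrPdist_le: gc => /(_ 1 ltr01); apply: filterS => p /=.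
  rewrite /y0 cmapK// => gp.
  rewrite -[rmetric sigma c (cinv c p) i j](subrK (rmetric sigma c x0 i j)).
  rewrite (le_trans (ler_normD _ _))// addrC lerD ?mx_entry_le//.
  by rewrite distrC.
have [r r0 rP] : exists2 r, 0 < r & forall p, `|y0 - p| < r ->
    (cmap c @` cdom c) p /\
    forall ij, `|rmetric sigma c (cinv c p) ij.1 ij.2| <= G.
  have /nbhs_ballP[r /= r0 rP] := @filterI _ _ (nbhs_filter y0) _ _ near_O near_G.
  by exists r => // p y0p; apply: rP; rewrite -ball_normE.
have [w wP] : exists w, forall x z, cdom c x -> cdom c z ->
    `|y0 - cmap c x| < r -> `|y0 - cmap c z| < r -> link sigma x z w.
  apply: (straight_link (G := G) Xc) => p /rP[Op Gp]; split=> // i j.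
  exact: (Gp (i, j)).
exists w; exists (cdom c `&` [set x | `|y0 - cmap c x| < r]).
  apply: filterI.
    by apply: open_nbhs_nbhs; split=> //; exact: cdom_open.
  by move/cvgrPdist_lt: (cmap_continuous cx0) => /(_ r r0).
by move=> x z [cx xr] [cz zr]; exact: wP.
Qed.

(** The points joined to [x0] form a set that is open and closed, hence everything; compactness, as
    near covering while the width tends to infinity, makes the width uniform. Links are directed, so
    [P] keeps both directions and two points are joined through [x0]. *)
Lemma links_bounded : compact [set: S] -> connected [set: S] ->
  [set: S] !=set0 -> exists W, forall x y : S, links sigma x y W.
Proof.
move=> cpt conn [x0 _].
pose P w y := links sigma x0 y w /\ links sigma y x0 w.
have P_step w w' y z : P w y -> link sigma y z w' -> link sigma z y w' -> P (w + w') z.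
  move=> [l1 l2] yz zy; split; first exact: links_trans l1 (links1 yz).
  by rewrite addrC; exact: links_trans (links1 zy) l2.
pose C := [set y | exists w, P w y].
have CT : C = [set: S].
  apply: conn.
  - by exists x0, 0; split; exact: links_nil.
  - exists C; last by rewrite setTI.
    rewrite openE => y [w Pwy]; have [w' [U Uy UP]] := locally_linked y; have Uyy := nbhs_singleton Uy.
    rewrite /interior; apply: filterS Uy => z Uz; exists (w + w').
    by apply: (P_step _ _ y) => //; apply: UP => //; exact: Uyy.
  - exists C; last by rewrite setTI.
    rewrite -openC openE => y nCy; have [w' [U Uy UP]] := locally_linked y; have Uyy := nbhs_singleton Uy.
    rewrite /interior; apply: filterS Uy => z Uz [w Pwz]; apply: nCy.
    exists (w + w').
    by apply: (P_step _ _ z) => //; apply: UP => //; exact: Uyy.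
move: cpt; rewrite compact_near_coveringP => /(_ R +oo P _) near_P.
have {}near_P : \forall w \near +oo, [set: S] `<=` P w.
  apply: near_P => y _; have [w Pwy] : C y by rewrite CT.
  have [w' [U Uy UP]] := locally_linked y; have Uyy := nbhs_singleton Uy.
  exists (U, [set k | w + w' < k]); first by split=> //; exact: (nbhs_pinfty_gt (num_real _)).
  move=> [z k] /= [Uz wk].
  have [l1 l2] : P (w + w') z.
    by apply: (P_step _ _ y) => //; apply: UP => //; exact: Uyy.
  by split; [apply: links_widen l1 _|apply: links_widen l2 _]; exact: ltW.
have [w wP] := @filter_ex _ _ proper_pinfty_nbhs _ near_P.
exists (w + w) => x y; have [_ l1] := wP x I; have [l2 _] := wP y I.
exact: links_trans l1 l2.
Qed.

End LocalLinks.

(** * Causal arcs and the null distance *)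

Section Chains.
Context (R : realType) (n : nat) (S : topologicalType).
Context (X : smoothManifold R n S) (sigma : riemannianMetric X).
Variables t0 t1 : R.
Implicit Types (f : R -> R) (beta : R -> R * S) (p q : R * S).

Definition causal_curve f a b beta : Prop :=
  future_causal_curve sigma f a b beta \/ past_causal_curve sigma f a b beta.

Definition causal_arc f p q : Prop := exists a b beta,
  [/\ a < b, causal_curve f a b beta, beta a = p, beta b = q &
      forall s, `[a, b]%classic s -> spacetime t0 t1 (beta s)].

Lemma smooth_extension_eq a b beta beta' alpha :
  (forall s, `[a, b]%classic s -> beta s = beta' s) ->
  smooth_extension X a b beta alpha -> smooth_extension X a b beta' alpha.
Proof. by move=> bb' [sa ab]; split=> // s abs; rewrite ab// bb'. Qed.

Lemma causal_curve_eq f a b beta beta' :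
  (forall s, `[a, b]%classic s -> beta s = beta' s) ->
  causal_curve f a b beta -> causal_curve f a b beta'.
Proof.
by move=> bb' [] [alpha sa v]; [left|right]; exists alpha => //;
  exact: smooth_extension_eq sa.
Qed.

Lemma shift_itv (a b d s : R) :
  `[a - d, b - d]%classic s -> `[a, b]%classic (s + d).
Proof. by rewrite /= !in_itv/= lerBlDr lerBrDr. Qed.

Lemma smooth_extension_shift a b beta alpha d :
  smooth_extension X a b beta alpha ->
  smooth_extension X (a - d) (b - d) (beta \o shift d) (alpha \o shift d).
Proof.
move=> [[U [oU abU sa]] e]; split; last first.
  by move=> s /shift_itv abs; exact: e.
have [oU' sa'] := smooth_curve_shift d oU sa.
exists (shift d @^-1` U); split; [exact: oU'| |exact: sa'].
by move=> s /shift_itv abs; exact: abU.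
Qed.

Lemma causal_curve_shift f a b beta d :
  causal_curve f a b beta -> causal_curve f (a - d) (b - d) (beta \o shift d).
Proof.
by move=> [] [alpha sa v]; [left|right]; exists (alpha \o shift d);
  do ?[exact: smooth_extension_shift];
  move=> s c /shift_itv abs Xc cs; rewrite velocity_shift; exact: v.
Qed.

(** Translating the parameter lets an arc begin where the interval of the preceding one ends. *)
Lemma arc_shift f p q a : causal_arc f p q -> exists b beta,
  [/\ a < b, causal_curve f a b beta, beta a = p, beta b = q &
      forall s, `[a, b]%classic s -> spacetime t0 t1 (beta s)].
Proof.
move=> [a' [b [beta [ab cb <- <- Mb]]]].
have [d ->] : exists d, a = a' - d by exists (a' - a); rewrite subKr.
exists (b - d), (beta \o shift d); split.
- by rewrite ltrD2r.
- exact: causal_curve_shift.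
- by rewrite /= subrK.
- by rewrite /= subrK.
- by move=> s /shift_itv; exact: Mb.
Qed.

(** The spatial part is kept and time is replaced by its affine image of slope [k]. As [f] is at
    most [|k|] on the levels met, the result is causal for [f]; the sign of [k] decides between
    future and past. *)
Lemma link_arc f x y w lo hi r k : link sigma x y w ->
  k != 0 -> t0 <= lo -> hi <= t1 ->
  (forall u, lo <= u <= hi -> 0 <= f u <= `|k|) ->
  lo <= r <= hi -> lo <= r + k * w <= hi -> causal_arc f (r, x) (r + k * w, y).
Proof.
move=> [a [b [U [alpha [ab oU abU sa [<- <- wE v]]]]]] k0 t0lo hit1 fk rlh rwlh.
pose d := r - k * (alpha a).1.
pose beta s := (d + k * (alpha s).1, (alpha s).2).
have beta_a : beta a = (r, (alpha a).2) by rewrite /beta /d subrK.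
have beta_b : beta b = (r + k * w, (alpha b).2).
  by rewrite /beta /d -wE mulrBr addrAC -addrA.
have time_mono s : `[a, b]%classic s -> lo <= (beta s).1 <= hi.
  move=> abs; have /andP[as_ sb] : a <= s <= b by move: abs; rewrite /= in_itv.
  have mono := time_increasing oU abU sa (fun s c abs Xc cs => (v s c abs Xc cs).1).
  have h1 : (alpha a).1 <= (alpha s).1.
    by move: as_; rewrite le_eqVlt => /predU1P[->//|as_]; rewrite ltW// mono.
  have h2 : (alpha s).1 <= (alpha b).1.
    by move: sb; rewrite le_eqVlt => /predU1P[->//|sb]; rewrite ltW// mono.
  have bE : (beta s).1 = r + k * ((alpha s).1 - (alpha a).1).
    by rewrite /= /d mulrBr addrAC -addrA.
  move: rlh rwlh; rewrite bE -wE => /andP[? ?] /andP[? ?].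
  have /orP[kp|kn] : (0 <= k) || (k <= 0) by exact: le_total.
    have := ler_wpM2l kp (lerB h1 (lexx (alpha a).1)).
    have := ler_wpM2l kp (lerB h2 (lexx (alpha a).1)).
    by lra.
  have := ler_wnM2l kn (lerB h1 (lexx (alpha a).1)).
  have := ler_wnM2l kn (lerB h2 (lexx (alpha a).1)).
  by lra.
have ext : smooth_extension X a b beta beta.
  split=> //; exists U; split; [exact: oU|exact: abU|].
  exact: smooth_curve_affine_time.
have speed s c : `[a, b]%classic s -> atlas X c -> cdom c (beta s).2 ->
    f (beta s).1 ^+ 2 * speed2 sigma c (beta s).2 (velocity c alpha s).2
      <= (k * (velocity c alpha s).1) ^+ 2.
  move=> abs Xc cs; have [_ vs] := v s c abs Xc cs.
  have /fk/andP[f0 fk'] := time_mono s abs.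
  rewrite exprMn ler_pM//; first exact: sqr_ge0.
    exact: speed2_ge0.
  by rewrite -(real_normK (num_real k)) lerXn2r ?nnegrE.
exists a, b, beta; split => //; last first.
  move=> s /time_mono /andP[? ?]; split => //=; rewrite in_itv/=.
  by rewrite (le_trans t0lo)// (le_trans _ hit1).
have [kn|kp|keq] := ltgtP k 0; last by rewrite keq eqxx in k0.
  right; exists beta => // s c abs Xc cs; apply/past_causalE.
  rewrite (velocity_affine_time _ _ _ oU sa (abU _ abs)); split; last exact: speed.
  by rewrite nmulr_rlt0//; exact: (v s c abs Xc cs).1.
left; exists beta => // s c abs Xc cs; apply/future_causalE.
rewrite (velocity_affine_time _ _ _ oU sa (abU _ abs)); split; last exact: speed.
by rewrite pmulr_rgt0//; exact: (v s c abs Xc cs).1.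
Qed.

Variable T : R -> R.

(** Piecewise causal curves with their null length, freed of parameters and partitions. The empty
    chain is an addition: a piecewise causal curve lives on an interval with [a < b]. *)
Inductive chain f : R * S -> R * S -> R -> Prop :=
| chain_nil p : chain f p p 0
| chain_cons p q r l : causal_arc f p q -> chain f q r l ->
    chain f p r (`|T q.1 - T p.1| + l).

Lemma chain_trans f p q r l l' :
  chain f p q l -> chain f q r l' -> chain f p r (l + l').
Proof.
move=> pq; elim: pq r l' => [*|{}p {}q s {}l a _ IH r l' /IH]; first by rewrite add0r.
by rewrite -addrA; exact: chain_cons.
Qed.

Lemma partition_nth (a b : R) s i : itv_partition a b s ->
  a <= nth b (a :: s) i <= b.
Proof.
elim: s a i => [|c s IH] a i.
  by move=> /itv_partition_nil ->; case: i => [|i]; rewrite /= ?nth_nil lexx.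
move=> pa; have /andP[ac _] := pa.1; have cb := itv_partition_cons pa.
case: i => [|i] /=; first by rewrite lexx (itv_partition_le pa).
by have /andP[ci ->] := IH c i cb; rewrite (le_trans (ltW ac) ci).
Qed.

Lemma variation_cons (a b c : R) (F : R -> R) s :
  variation a b F (c :: s) = `|F c - F a| + variation c b F s.
Proof. by rewrite /variation /= big_nat_recl. Qed.

Lemma chain_piecewise f p q l : chain f p q l ->
  (p = q /\ l = 0) \/
  forall a, exists b s beta, [/\ piecewise_causal sigma t0 t1 f a b s beta,
    beta a = p, beta b = q & null_length (fun p => T p.1) a b s beta = l].
Proof.
elim=> [{}p|{}p {}q r {}l pq _ IH]; [by left|right=> a].
have [c [beta [ac cb <- cq Mb]]] := arc_shift a pq.
case: IH => [[qr ->]|/(_ c) [b [s [gamma [[cb' pb Mg piece] gc <- <-]]]]].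
  exists c, [:: c], beta; split => //; last first.
  - by rewrite /null_length variation_cons /variation big_nil !addr0 /= cq.
  - by rewrite cq.
  by split => // [|[|i]//]; exact: itv_partition1.
(* Both curves agree at [c], so [delta] equals [gamma] on all of [[c, b]] and each piece keeps its
   own smooth extension. *)
pose delta x := if x <= c then beta x else gamma x.
have dbeta x : `[a, c]%classic x -> beta x = delta x.
  by rewrite /= in_itv /delta /= => /andP[_ ->].
have dgamma x : c <= x -> gamma x = delta x.
  rewrite /delta le_eqVlt => /predU1P[<-|cx]; first by rewrite lexx cq.
  by rewrite leNgt cx.
exists b, (c :: s), delta; split.
- split.
  + exact: lt_trans cb'.
  + by have [sp sl] := pb; split=> //=; rewrite ac.
  + move=> x; rewrite /= in_itv/= => /andP[ax xb].
    rewrite /delta; case: ifPn => xc; first by apply: Mb; rewrite /= in_itv/= ax.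
    by apply: Mg; rewrite /= in_itv/= xb ltW// ltNge.
  + move=> [_|i]; first exact: causal_curve_eq cb.
    rewrite /= ltnS => /piece; apply: causal_curve_eq => x.
    rewrite /= in_itv/= => /andP[ix _]; apply: dgamma; apply: le_trans ix.
    by have /andP[] := partition_nth i pb.
- by rewrite -dbeta//= in_itv/= lexx ltW.
- by rewrite -dgamma// ltW.
rewrite /null_length variation_cons /= -!dbeta /= ?in_itv/= ?lexx ?(ltW ac)// cq.
congr (_ + _); rewrite /variation; apply: eq_bigr => i _ /=.
by rewrite -!dgamma//; [have /andP[] := partition_nth i pb|have /andP[] := partition_nth i.+1 pb].
Qed.

Lemma piecewise_chain f a b s beta : piecewise_causal sigma t0 t1 f a b s beta ->
  chain f (beta a) (beta b) (null_length (fun p => T p.1) a b s beta).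
Proof.
move=> [_]; elim: s a => [|c s IH] a pb Mb piece.
  by rewrite (itv_partition_nil pb) /null_length /variation big_nil; exact: chain_nil.
rewrite /null_length variation_cons.
have /andP[ac _] := pb.1; have cb := itv_partition_cons pb.
have cb' := itv_partition_le cb.
apply: (@chain_cons f (beta a) (beta c)).
  exists a, c, beta; split => //; first exact: (piece 0%N).
  move=> x; rewrite /= in_itv/= => /andP[ax xc]; apply: Mb.
  by rewrite /= in_itv/= ax (le_trans xc).
apply: IH => // [x|i si].
  rewrite /= in_itv/= => /andP[cx xb]; apply: Mb.
  by rewrite /= in_itv/= xb (le_trans (ltW ac)).
exact: (piece i.+1).
Qed.

Lemma null_distance_chain_lt f p q (d : R) :
  (null_distance sigma t0 t1 f (fun p => T p.1) p q < d%:E)%E ->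
  exists2 l, l < d & chain f p q l.
Proof.
move=> /ereal_inf_lt[_ [a [b [s [beta [pc <- <- ->]]]]]]; rewrite lte_fin => ld.
by exists (null_length (fun p => T p.1) a b s beta) => //; exact: piecewise_chain.
Qed.

End Chains.

(** * Conformal time *)

Section ConformalTime.
Context (R : realType) (t0 t1 : R) (t01 : t0 < t1).
Implicit Types (f g h : R -> R).

Let cont h := {within `[t0, t1], continuous h}.

Lemma cont_eps h u e : cont h -> t0 <= u <= t1 -> 0 < e ->
  exists2 r, 0 < r &
    forall v, t0 <= v <= t1 -> `|u - v| < r -> `|h u - h v| < e.
Proof.
move=> /subspace_continuousP ch u01 e0.
have /cvgrPdist_lt /(_ e e0) : h x @[x --> within `[t0, t1] (nbhs u)] --> h u.
  by apply: ch; rewrite /= in_itv.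
move=> /nbhs_normP[r /= r0 rP]; exists r => // v v01 uv.
by apply: (rP v) => //=; rewrite in_itv.
Qed.

(** Uniform continuity in multiplicative form, by compactness of the interval as [d] tends to [0]
    from the right. *)
Lemma uniform_ratio f e : cont f -> (forall t, t0 <= t <= t1 -> 0 < f t) ->
  0 < e -> exists2 d, 0 < d & forall u v, t0 <= u <= t1 -> t0 <= v <= t1 ->
    `|u - v| < d -> f u <= (1 + e) * f v.
Proof.
move=> cf f0 e0.
pose P (d u : R) := t0 <= u <= t1 -> forall v, t0 <= v <= t1 ->
  `|u - v| < d -> f u <= (1 + e) * f v.
have := @segment_compact R t0 t1; rewrite compact_near_coveringP.
move=> /(_ _ (0^'+) P _) near_P.
have {}near_P : \forall d \near (0:R)^'+, `[t0, t1] `<=` P d.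
  apply: near_P => u; rewrite /= in_itv /= => u01; have fu := f0 u u01.
  (* Chosen so that [f u + k = (1 + e) * (f u - k)]: these are the extreme values allowed within [k]
     of [f u]. *)
  pose k := f u * e / (2 + e).
  have k0 : 0 < k by rewrite divr_gt0 ?mulr_gt0// addr_gt0.
  have [r r0 rP] := cont_eps cf u01 k0.
  exists ([set v | `|u - v| < r / 2], [set d | d < r / 2]).
    split; first by apply/nbhs_normP; exists (r / 2) => //=; rewrite divr_gt0.
    by apply: nbhs_right_lt; rewrite divr_gt0.
  move=> [u' d] /= [uu' dr] u'01 v v01 u'v.
  have ur : `|u - u'| < r by rewrite (lt_trans uu')// ltr_pdivrMr// ltr_pMr// ltr1n.
  have vr : `|u - v| < r.
    by rewrite -(subrKA u') (le_lt_trans (ler_normD _ _))// [r]splitr ltrD// (lt_trans u'v).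
  have := rP _ u'01 ur; have := rP _ v01 vr.
  rewrite !ltr_norml => /andP[_ h1] /andP[h2 _].
  have kE : (2 + e) * k = e * f u.
    rewrite /k [LHS]mulrC divfK; [exact: mulrC|by rewrite gt_eqF// addr_gt0].
  have : (1 + e) * (f u - f v) <= (1 + e) * k by rewrite ler_wpM2l ?ltW// addr_gt0.
  by lra.
have [d [d0 dP]] := @filter_ex _ _ (at_right_proper_filter (0:R)) _
  (filterI (nbhs_right_gt (0:R)) near_P).
exists d => // u v u01; apply: (dP u) => //; by rewrite /= in_itv.
Qed.

Lemma cont_bounds f : cont f -> (forall t, t0 <= t <= t1 -> 0 < f t) ->
  exists m, exists2 N, 0 < m & forall t, t0 <= t <= t1 -> m <= f t <= N.
Proof.
move=> cf f0; have [c c01 cP] := EVT_min (ltW t01) cf.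
have [d d01 dP] := EVT_max (ltW t01) cf.
exists (f c), (f d); first by apply: f0; move: c01; rewrite in_itv.
by move=> t t01'; rewrite cP ?dP// in_itv.
Qed.

Lemma cont_inv f : cont f -> (forall t, t0 <= t <= t1 -> 0 < f t) ->
  cont (fun t => (f t)^-1).
Proof.
move=> /subspace_continuousP cf f0; apply/subspace_continuousP => x x01.
apply: cvgV; last exact: cf.
by rewrite gt_eqF// f0//; move: x01; rewrite /= in_itv.
Qed.

Let mu := @lebesgue_measure R.
Definition primitive h (t : R) : R := \int[mu]_(r in `[t0, t]) h r.

Lemma cont_integrable h s t : cont h -> t0 <= s -> t <= t1 ->
  mu.-integrable `[s, t] (EFin \o h).
Proof.
move=> ch s0 t1'; apply: continuous_compact_integrable; first exact: segment_compact.
by apply: continuous_subspaceW ch; apply: subset_itv; rewrite bnd_simp.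
Qed.

Lemma primitive_increment h s t : cont h -> t0 <= s -> s <= t -> t <= t1 ->
  primitive h t - primitive h s = \int[mu]_(r in `[s, t]) h r.
Proof.
move=> ch s0 st t1'; rewrite /primitive Rintegral_itvB ?bnd_simp//.
  rewrite Rintegral_itv_obnd_cbnd//.
  apply: integrableS (cont_integrable ch s0 t1') => //.
  by apply: subset_itv; rewrite bnd_simp.
exact: cont_integrable.
Qed.

Lemma cont_cst (c : R) : cont (fun _ => c).
Proof. by move=> x; exact: cvg_cst. Qed.

Lemma integral_cst_itv (s t c : R) : s <= t ->
  \int[mu]_(r in `[s, t]) c = c * (t - s).
Proof.
move=> st; rewrite Rintegral_cst//; congr (_ * _).
have := lebesgue_measure_itv `[s, t]; rewrite /= lte_fin /mu => ->.
by case: ltgtP st => //= -> _; rewrite subrr.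
Qed.

Lemma primitive_le h g s t : cont h -> cont g -> t0 <= s -> s <= t -> t <= t1 ->
  (forall u, s <= u <= t -> h u <= g u) ->
  primitive h t - primitive h s <= primitive g t - primitive g s.
Proof.
move=> ch cg s0 st t1' hg; rewrite !primitive_increment//.
apply: (le_Rintegral _ (cont_integrable ch s0 t1') (cont_integrable cg s0 t1')).
  exact: measurable_itv.
by move=> u; rewrite /= in_itv/=; exact: hg.
Qed.

Lemma primitive_cst_increment c s t : t0 <= s -> s <= t -> t <= t1 ->
  primitive (fun _ => c) t - primitive (fun _ => c) s = c * (t - s).
Proof. by move=> *; rewrite primitive_increment ?integral_cst_itv//; exact: cont_cst. Qed.

Lemma primitive_nondecreasing h s t : cont h ->
  (forall u, t0 <= u <= t1 -> 0 <= h u) ->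
  t0 <= s -> s <= t -> t <= t1 -> primitive h s <= primitive h t.
Proof.
move=> ch h0 s0 st t1'; rewrite -subr_ge0 primitive_increment//.
apply: Rintegral_ge0 => u; rewrite /= in_itv/= => /andP[su ut]; apply: h0.
by rewrite (le_trans s0 su) (le_trans ut t1').
Qed.

Lemma cont_sub h g : cont h -> cont g -> cont (fun u => h u - g u).
Proof. by move=> ch cg x; apply: cvgB; [exact: ch|exact: cg]. Qed.

Lemma cont_scale c h : cont h -> cont (fun u => c * h u).
Proof. by move=> ch x; apply: cvgM; [exact: cvg_cst|exact: ch]. Qed.

Lemma primitive_sub_fun h g s t : cont h -> cont g -> t0 <= s -> s <= t -> t <= t1 ->
  primitive (fun u => h u - g u) t - primitive (fun u => h u - g u) s =
  (primitive h t - primitive h s) - (primitive g t - primitive g s).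
Proof.
move=> ch cg s0 st t1'.
rewrite (primitive_increment (cont_sub ch cg))// (primitive_increment ch)// (primitive_increment cg)//.
by rewrite (RintegralB _ (cont_integrable ch s0 t1') (cont_integrable cg s0 t1')).
Qed.

Lemma primitive_scale_fun c h s t : cont h -> t0 <= s -> s <= t -> t <= t1 ->
  primitive (fun u => c * h u) t - primitive (fun u => c * h u) s =
  c * (primitive h t - primitive h s).
Proof.
move=> ch s0 st t1'; rewrite (primitive_increment (cont_scale (c := c) ch))// (primitive_increment ch)//.
by rewrite (RintegralZl _ _ (cont_integrable ch s0 t1')).
Qed.

Lemma primitive_t0 h : primitive h t0 = 0.
Proof. by rewrite /primitive set_itv1 Rintegral_set1. Qed.

Section Comparison.
Variables f g : R -> R.
Hypotheses (cf : cont f) (cg : cont g).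
Let dist (u : R) : R := `|f u - g u|.

Let cdist : cont dist.
Proof.
move=> x; apply: (@cvg_norm _ R); apply: cvgB; [exact: cf|exact: cg].
Qed.

Let dist_total s t : t0 <= s -> s <= t -> t <= t1 ->
  primitive dist t - primitive dist s <= primitive dist t1.
Proof.
move=> s0 st t1'; have d0 u : t0 <= u <= t1 -> 0 <= dist u by move=> _; exact: normr_ge0.
have := primitive_nondecreasing cdist d0 (le_trans s0 st) t1' (lexx _).
have := primitive_nondecreasing cdist d0 (lexx _) s0 (le_trans st t1').
by rewrite primitive_t0; lra.
Qed.

(** Otherwise the distance is at least [e] throughout [[s, t]] and its integral at least
    [e * (t - s)]. *)
Lemma near_point_of_L1 s t e : t0 <= s -> s <= t -> t <= t1 ->
  primitive dist t1 < e * (t - s) -> exists2 u, s <= u <= t & f u < g u + e.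
Proof.
move=> s0 st t1' small; apply/not_exists2P => far.
have : e * (t - s) <= primitive dist t - primitive dist s.
  rewrite -(primitive_cst_increment e s0 st t1'); apply: primitive_le => //; first exact: cont_cst.
  move=> u su; have [//|/negP] := far u; rewrite -leNgt => h.
  by apply: le_trans (ler_norm _); rewrite lerBrDl.
have := dist_total s0 st t1'.
by move: small; lra.
Qed.

(** Pointwise, [1 / g - 1 / f = (f - g) / (f * g)], and both factors of the denominator are at least
    [m]. *)
Lemma primitive_inv_close (m s t : R) : 0 < m ->
  (forall u, t0 <= u <= t1 -> m <= g u <= f u) ->
  t0 <= s -> s <= t -> t <= t1 ->
  (primitive (fun u => (g u)^-1) t - primitive (fun u => (g u)^-1) s) -
  (primitive (fun u => (f u)^-1) t - primitive (fun u => (f u)^-1) s)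
    <= m^-2 * primitive dist t1.
Proof.
move=> m0 mgf s0 st t1'.
have g0 u : t0 <= u <= t1 -> 0 < g u.
  by move=> /mgf/andP[mg _]; exact: lt_le_trans mg.
have f0 u : t0 <= u <= t1 -> 0 < f u.
  by move=> /[dup] u01 /mgf/andP[_ gf]; rewrite (lt_le_trans (g0 u u01)).
rewrite -(primitive_sub_fun (cont_inv cg g0) (cont_inv cf f0))//.
apply: (@le_trans _ _ (primitive (fun u => m^-2 * dist u) t -
    primitive (fun u => m^-2 * dist u) s)).
  apply: (primitive_le (cont_sub (cont_inv cg g0) (cont_inv cf f0))
    (cont_scale cdist) s0 st t1') => u /andP[su ut].
  have u01 : t0 <= u <= t1 by rewrite (le_trans s0 su) (le_trans ut t1').
  have /andP[mg gf] := mgf u u01.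
  have fu := f0 u u01; have gu := g0 u u01.
  have -> : (g u)^-1 - (f u)^-1 = (f u * g u)^-1 * (f u - g u).
    by field; rewrite !gt_eqF.
  apply: ler_pM; [|by rewrite subr_ge0| |exact: ler_norm].
    by rewrite invr_ge0 mulr_ge0// ltW.
  rewrite lef_pV2 ?posrE ?mulr_gt0// expr2.
  apply: ler_pM => //; [exact: ltW|exact: ltW|exact: le_trans gf].
rewrite (primitive_scale_fun _ cdist)//; apply: ler_wpM2l; last exact: dist_total.
by rewrite invr_ge0 exprn_ge0// ltW.
Qed.

End Comparison.

End ConformalTime.

(** * Climbing along a spatial link *)

Section PrimitiveBounds.
Context (R : realType) (t0 t1 : R).

Lemma primitive_bounds (h : R -> R) (m C s t : R) :
  {within `[t0, t1], continuous h} -> t0 <= s -> s <= t -> t <= t1 ->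
  (forall u, s <= u <= t -> m <= h u <= C) ->
  m * (t - s) <= primitive t0 h t - primitive t0 h s <= C * (t - s).
Proof.
move=> ch s0 st t1' hb; rewrite -!(primitive_cst_increment (t0 := t0) (t1 := t1))//; apply/andP; split.
  by apply: (primitive_le (@cont_cst _ _ _ _) ch s0 st t1') => u /hb/andP[].
by apply: (primitive_le ch (@cont_cst _ _ _ _) s0 st t1') => u /hb/andP[].
Qed.

Lemma primitive_lipschitz (h : R -> R) (C lo hi s t : R) :
  {within `[t0, t1], continuous h} -> t0 <= lo -> hi <= t1 ->
  (forall u, lo <= u <= hi -> 0 <= h u <= C) ->
  lo <= s <= hi -> lo <= t <= hi ->
  `|primitive t0 h s - primitive t0 h t| <= C * `|s - t|.
Proof.
move=> ch t0lo hit1 hb.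
wlog st : s t / s <= t => [H s01 t01'|/andP[s0 s1] /andP[t0' t1']].
  have [/H|/ltW/H] := leP s t; first exact.
  by rewrite distrC [`|t - s|]distrC; exact.
have {}hb u : s <= u <= t -> 0 <= h u <= C.
  by move=> /andP[su ut]; rewrite hb// (le_trans s0 su) (le_trans ut t1').
have /andP[l u] := primitive_bounds ch (le_trans t0lo s0) st (le_trans t1' hit1) hb.
rewrite mul0r subr_ge0 in l.
by rewrite distrC [`|s - t|]distrC !ger0_norm ?subr_ge0.
Qed.

End PrimitiveBounds.

Section Transport.
Context (R : realType) (n : nat) (S : topologicalType).
Context (X : smoothManifold R n S) (sigma : riemannianMetric X).
Variables (t0 t1 : R) (T : R -> R).
Hypothesis t01 : t0 < t1.
Hypothesis T_mono : forall s t, t0 <= s -> s <= t -> t <= t1 -> T s <= T t.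
Implicit Types (f : R -> R) (x y : S).

Notation chain f := (chain sigma t0 t1 T f).

(** All links of the path receive the same slope [k], so time is monotone along the whole block and
    the increments of [T] add up without cancellation. *)
Lemma block_chain f x y w (lo hi r k : R) : links sigma x y w ->
  k != 0 -> t0 <= lo -> hi <= t1 ->
  (forall u, lo <= u <= hi -> 0 <= f u <= `|k|) ->
  lo <= r <= hi -> lo <= r + k * w <= hi ->
  chain f (r, x) (r + k * w, y) `|T (r + k * w) - T r|.
Proof.
move=> l k0 t0lo hit1 fk; elim: l r => [z r _ _|{}x z {}y w1 w2 xz ls IH r].
  by rewrite mulr0 addr0 subrr normr0; exact: chain_nil.
have w1_gt0 := link_gt0 xz; have w2_ge0 := links_ge0 ls.
rewrite mulrDr addrA => /andP[lor rhi] /andP[loe ehi].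
have kle : (0 <= k) || (k <= 0) by exact: le_total.
have [lor1 r1hi] : lo <= r + k * w1 /\ r + k * w1 <= hi.
  by case/orP: kle => kp; split; nra.
have -> : `|T (r + k * w1 + k * w2) - T r| =
    `|T (r + k * w1) - T r| + `|T (r + k * w1 + k * w2) - T (r + k * w1)|.
  case/orP: kle => kp.
    have h1 : T r <= T (r + k * w1) by apply: T_mono; nra.
    have h2 : T (r + k * w1) <= T (r + k * w1 + k * w2) by apply: T_mono; nra.
    by rewrite !ger0_norm ?subr_ge0//; [lra|exact: le_trans h2].
  have h1 : T (r + k * w1) <= T r by apply: T_mono; nra.
  have h2 : T (r + k * w1 + k * w2) <= T (r + k * w1) by apply: T_mono; nra.
  by rewrite !ler0_norm ?subr_le0//; [lra|exact: le_trans h1].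
apply: (chain_cons (q := (r + k * w1, z))).
  by apply: (link_arc xz k0 t0lo hit1 fk); apply/andP.
by apply: IH; apply/andP.
Qed.

Section Rise.
Variable f : R -> R.
Hypothesis f_cont : {within `[t0, t1], continuous f}.
Hypothesis f_pos : forall t, t0 <= t <= t1 -> 0 < f t.
Let F := primitive t0 (fun u => (f u)^-1).

Lemma inv_primitive_mono s t : t0 <= s -> s <= t -> t <= t1 -> F s <= F t.
Proof.
apply: (primitive_nondecreasing (cont_inv f_cont f_pos)) => u u01.
by rewrite invr_ge0 ltW// f_pos.
Qed.

Lemma inv_primitive_strict s t : t0 <= s -> s < t -> t <= t1 -> F s < F t.
Proof.
move=> s0 st t1'; have [m [N m0 mN]] := cont_bounds t01 f_cont f_pos.
have u01 u : s <= u <= t -> t0 <= u <= t1.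
  by move=> /andP[su ut]; rewrite (le_trans s0 su) (le_trans ut t1').
have mf u : s <= u <= t -> N^-1 <= (f u)^-1 <= m^-1.
  move=> /u01 u'; have /andP[mu uN] := mN u u'; have fu := f_pos u'.
  by rewrite !lef_pV2 ?posrE ?mu ?uN// (lt_le_trans fu).
have [] := andP (primitive_bounds (cont_inv f_cont f_pos) s0 (ltW st) t1' mf).
move=> h _; rewrite -subr_gt0; apply: lt_le_trans h.
have /andP[mu uN] : m <= f s <= N by apply: mN; rewrite s0 (le_trans (ltW st)).
by rewrite mulr_gt0 ?subr_gt0// invr_gt0 (lt_le_trans m0)// (le_trans mu).
Qed.

(** On a short interval [F b - F a] is [(b - a) / f u] up to the factor [1 + e]. The first bound
    provides a slope dominating [f] for climbing; the second serves to extract links from causal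
    curves. *)
Lemma short_interval e : 0 < e -> exists2 d, 0 < d &
  forall a b u, t0 <= a -> a <= u -> u <= b -> b <= t1 -> b - a < d ->
  f u * ((F b - F a) / (1 + e)) <= b - a /\ b - a <= f u * ((1 + e) * (F b - F a)).
Proof.
move=> e0; have e1 : 0 < 1 + e by rewrite addr_gt0.
have [d d0 dP] := uniform_ratio f_cont f_pos e0.
exists d => // a b u a0 au ub b1 bad.
have in01 v : a <= v <= b -> t0 <= v <= t1.
  by move=> /andP[av vb]; rewrite (le_trans a0 av) (le_trans vb b1).
have close v : a <= v <= b -> f u <= (1 + e) * f v /\ f v <= (1 + e) * f u.
  move=> avb; have /andP[av vb] := avb.
  have uv : `|u - v| < d.
    by rewrite (le_lt_trans _ bad)// ler_norml; lra.
  by split; apply: dP; rewrite ?in01 ?au// distrC.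
have fu : 0 < f u by apply: f_pos; rewrite in01// au.
have bnd v : a <= v <= b -> ((1 + e) * f u)^-1 <= (f v)^-1 <= (1 + e) / f u.
  move=> avb; have [h1 h2] := close v avb; have fv := f_pos (in01 v avb).
  rewrite lef_pV2 ?posrE ?mulr_gt0// h2 /= -(invrK (1 + e)) -invfM.
  by rewrite lef_pV2 ?posrE ?mulr_gt0 ?invr_gt0// mulrC ler_pdivrMr// mulrC.
have /andP[] := primitive_bounds (cont_inv f_cont f_pos) a0 (le_trans au ub) b1 bnd.
rewrite -/F => h1 h2; split.
  rewrite mulrA ler_pdivrMr//; apply: le_trans (ler_wpM2l (ltW fu) h2) _.
  by rewrite le_eqVlt; apply/orP; left; apply/eqP; field; rewrite gt_eqF.
by rewrite mulrA [f u * _]mulrC -ler_pdivrMl// mulr_gt0.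
Qed.

Lemma rise_or_fall_short (e a b : R) x y (lam : R) : t0 <= a -> a <= b -> b <= t1 ->
  0 < e -> 0 < lam ->
  links sigma x y ((F b - F a) / (1 + e)) ->
  lam * ((F b - F a) / (1 + e)) = b - a ->
  (forall u, a <= u <= b -> f u <= lam) ->
  chain f (a, x) (b, y) (T b - T a) /\ chain f (b, x) (a, y) (T b - T a).
Proof.
move=> a0 ab b1 e0 lam0 xy lamE flam.
have fk (k u : R) : `|k| = lam -> a <= u <= b -> 0 <= f u <= `|k|.
  move=> -> /[dup] uab /flam ->; rewrite andbT ltW// f_pos//.
  by case/andP: uab => au ub; rewrite (le_trans a0 au) (le_trans ub b1).
have lamn : `|lam| = lam by rewrite ger0_norm// ltW.
have lamnn : `|- lam| = lam by rewrite normrN.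
have up : a + lam * ((F b - F a) / (1 + e)) = b by rewrite lamE addrC subrK.
have down : b + (- lam) * ((F b - F a) / (1 + e)) = a by rewrite mulNr lamE subKr.
have Tab : T a <= T b by exact: T_mono.
split.
  have := block_chain (r := a) (k := lam) xy (lt0r_neq0 lam0) a0 b1 (fun u => fk _ u lamn).
  by rewrite up ger0_norm ?subr_ge0// !lexx !ab; apply.
have nk : - lam != 0 by rewrite oppr_eq0 lt0r_neq0.
have := block_chain (r := b) (k := - lam) xy nk a0 b1 (fun u => fk _ u lamnn).
by rewrite down ler0_norm ?subr_le0// opprB !lexx !ab; apply.
Qed.

(* The levels between [a] and [b] are climbed along blocks so short that [f] is
   almost constant on each; since the width available to a causal curve that
   climbs from [a] to [b] is [F b - F a], the factor [1 + e] leaves enough room. *)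
Lemma rise_or_fall e a b x y : 0 < e -> t0 <= a -> a <= b -> b <= t1 ->
  links sigma x y ((F b - F a) / (1 + e)) ->
  chain f (a, x) (b, y) (T b - T a) /\ chain f (b, x) (a, y) (T b - T a).
Proof.
move=> e0; have [d d0 dP] := short_interval e0.
have e1 : 0 < 1 + e by rewrite addr_gt0.
pose d' := d / 2.
have d'0 : 0 < d' by rewrite divr_gt0.
have d'd : d' < d by rewrite ltr_pdivrMr// ltr_pMr// ltr1n.
move=> a0 ab b1 xy.
have [N] : exists N : nat, b - a <= N%:R * d'.
  exists (Num.Def.archi_bound ((b - a) / d')); rewrite -ler_pdivrMr//.
  by rewrite ltW// archi_boundP// divr_ge0 ?subr_ge0// ltW.
have short a' b' x' y' : t0 <= a' -> a' <= b' -> b' <= t1 -> b' - a' <= d' ->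
    links sigma x' y' ((F b' - F a') / (1 + e)) ->
    chain f (a', x') (b', y') (T b' - T a') /\ chain f (b', x') (a', y') (T b' - T a').
  move=> a'0 + b'1 short l; rewrite le_eqVlt => /predU1P[abE|ab'].
    (* Height and width both vanish here, so any positive slope bounding [f] at this level will
       do. *)
    subst b'; apply: (rise_or_fall_short (lam := f a') a'0 (lexx _) b'1 e0 _ l).
    + by apply: f_pos; rewrite a'0.
    + by rewrite !subrr mul0r mulr0.
    + by move=> u; rewrite -eq_le => /eqP ->.
  have w0 : 0 < (F b' - F a') / (1 + e).
    by rewrite divr_gt0// subr_gt0 inv_primitive_strict.
  (* The slope that spends exactly the available width over the height [b' - a']. *)
  apply: (rise_or_fall_short (lam := (b' - a') / ((F b' - F a') / (1 + e)))
    a'0 (ltW ab') b'1 e0 _ l).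
  + by rewrite divr_gt0// subr_gt0.
  + by rewrite divfK// gt_eqF.
  + move=> u /andP[au ub]; rewrite ler_pdivlMr//.
    by have [] := dP a' b' u a'0 au ub b'1 (le_lt_trans short d'd).
elim: N => [|N IH] in a b x y a0 ab b1 xy *.
  move=> h; apply: short => //; rewrite (le_trans h)// mul0r; exact: ltW.
move=> baN; have [bad|bad] := leP (b - a) d'; first exact: short.
pose m := a + d'.
have am : a <= m by rewrite lerDl ltW.
have mb : m <= b by rewrite -lerBrDl ltW.
have m0 : t0 <= m by exact: le_trans am.
have m1 : m <= t1 by exact: le_trans b1.
have Fam : F a <= F m by exact: inv_primitive_mono.
have Fmb : F m <= F b by exact: inv_primitive_mono.
have splitE : (F b - F a) / (1 + e) = (F m - F a) / (1 + e) + (F b - F m) / (1 + e).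
  by rewrite -mulrDl; congr (_ / _); lra.
have w1 : 0 <= (F m - F a) / (1 + e) by rewrite divr_ge0 ?subr_ge0// ltW.
have w2 : 0 <= (F b - F m) / (1 + e) by rewrite divr_ge0 ?subr_ge0// ltW.
have maE : m - a <= d' by rewrite /m addrC addKr.
have bmE : b - m <= N%:R * d' by move: baN; rewrite /m -natr1 mulrDl mul1r; lra.
split.
  have [|z [xz zy]] := links_split xy (u := (F m - F a) / (1 + e)).
    by rewrite w1 splitE lerDl.
  rewrite splitE addrC addrA addNr add0r in zy.
  have [up _] := short a m x z a0 am m1 maE xz.
  have [up' _] := IH m b z y m0 mb b1 zy bmE.
  have -> : T b - T a = T m - T a + (T b - T m) by lra.
  exact: chain_trans up up'.
(* A fall meets the upper part first, so the initial share of the path is the width of [[m, b]]. *)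
have [|z [xz zy]] := links_split xy (u := (F b - F m) / (1 + e)).
  by rewrite w2 splitE lerDr.
rewrite splitE addrK in zy.
have [_ dn] := IH m b x z m0 mb b1 xz bmE.
have [_ dn'] := short a m z y a0 am m1 maE zy.
have -> : T b - T a = T b - T m + (T m - T a) by lra.
exact: chain_trans dn dn'.
Qed.

Lemma transport e t s x y : 0 < e -> t0 <= t <= t1 -> t0 <= s <= t1 ->
  links sigma x y (`|F s - F t| / (1 + e)) ->
  chain f (t, x) (s, y) `|T s - T t|.
Proof.
move=> e0 /andP[t_0 t_1] /andP[s_0 s_1].
have [ts|/ltW st] := leP t s.
  rewrite !ger0_norm ?subr_ge0 ?T_mono ?inv_primitive_mono// => l.
  by have [] := rise_or_fall e0 t_0 ts s_1 l.
rewrite distrC [`|T s - _|]distrC.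
rewrite !ger0_norm ?subr_ge0 ?T_mono ?inv_primitive_mono// => l.
by have [] := rise_or_fall e0 s_0 st t_1 l.
Qed.

Lemma vertical_chain t s x : t0 <= t <= t1 -> t0 <= s <= t1 ->
  chain f (t, x) (s, x) `|T s - T t|.
Proof.
move=> t01' s01'; apply: (transport (e := 1)) => //.
by apply: links_widen (links_nil _ _) _; rewrite divr_ge0// addr_ge0.
Qed.

End Rise.

End Transport.

(** * From causal chains to spatial links *)

Section Comparison.
Context (R : realType) (n : nat) (S : topologicalType).
Context (X : smoothManifold R n S) (sigma : riemannianMetric X).
Variables (t0 t1 : R).
Variable g : R -> R.
Hypothesis g_cont : {within `[t0, t1], continuous g}.
Hypothesis g_pos : forall t, t0 <= t <= t1 -> 0 < g t.
Let T := primitive t0 (fun u => (g u)^-1).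
Implicit Types (f : R -> R) (x y : S) (p q : R * S).

Lemma time_strict_monotone a b (U : set R) (alpha : R -> R * S) k : open U ->
  `[a, b] `<=` U -> smooth_curve_on X U alpha ->
  (forall s (c : chart R n S), `[a, b]%classic s -> atlas X c ->
     cdom c (alpha s).2 -> 0 < k * (velocity c alpha s).1) ->
  forall s s', a <= s -> s < s' -> s' <= b -> k * (alpha s).1 < k * (alpha s').1.
Proof.
move=> oU abU sa v0 s s' sa' ss' sb'.
pose beta s := (0 + k * (alpha s).1, (alpha s).2).
have vb r (c : chart R n S) : `[a, b]%classic r -> atlas X c ->
    cdom c (beta r).2 -> 0 < (velocity c beta r).1.
  by move=> abr Xc cr; rewrite (velocity_affine_time _ _ _ oU sa (abU _ abr)); exact: v0.
have := time_increasing oU abU (smooth_curve_affine_time k 0 oU sa) vb sa' ss' sb'.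
by rewrite /= !add0r.
Qed.

(* [k] is [1] for a future causal curve and [-1] for a past causal one. *)
Lemma curve_links a b (U : set R) (alpha : R -> R * S) e k :
  k * k = 1 -> 0 < e -> a < b -> open U ->
  `[a, b] `<=` U -> smooth_curve_on X U alpha ->
  (forall s, `[a, b]%classic s -> t0 <= (alpha s).1 <= t1) ->
  (forall s c, `[a, b]%classic s -> atlas X c -> cdom c (alpha s).2 ->
     0 < k * (velocity c alpha s).1 /\
     g (alpha s).1 ^+ 2 * speed2 sigma c (alpha s).2 (velocity c alpha s).2
       <= (velocity c alpha s).1 ^+ 2) ->
  links sigma (alpha a).2 (alpha b).2
    ((1 + e) * (k * (T (alpha b).1 - T (alpha a).1))).
Proof.
move=> k1 e0 ab oU abU sa M01 v.
have e1 : 0 < 1 + e by rewrite addr_gt0.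
have [d d0 dP] := short_interval g_cont g_pos e0.
pose d' := d / 2.
have d'0 : 0 < d' by rewrite divr_gt0.
have d'd : d' < d by rewrite ltr_pdivrMr// ltr_pMr// ltr1n.
have v0 s (c : chart R n S) abs Xc cs := (v s c abs Xc cs).1.
have mono := time_strict_monotone oU abU sa v0.
have short a' b' : a <= a' -> a' < b' -> b' <= b ->
    k * ((alpha b').1 - (alpha a').1) <= d' ->
    links sigma (alpha a').2 (alpha b').2
      ((1 + e) * (k * (T (alpha b').1 - T (alpha a').1))).
  move=> aa' ab' bb' small; apply: links1.
  have sub s : `[a', b']%classic s -> `[a, b]%classic s.
    by apply: subset_itv; rewrite bnd_simp.
  set A := (alpha a').1 in small *; set B := (alpha b').1 in small *.
  set D := (1 + e) * (k * (T B - T A)).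
  have AB : 0 < k * (B - A) by rewrite mulrBr subr_gt0; exact: mono.
  have aS : `[a, b]%classic a' by apply: sub; rewrite /= in_itv/= lexx ltW.
  have bS : `[a, b]%classic b' by apply: sub; rewrite /= in_itv/= lexx ltW.
  have /andP[A0 A1] := M01 a' aS; have /andP[B0 B1] := M01 b' bS.
  have key s : `[a', b']%classic s -> k * (B - A) <= g (alpha s).1 * D.
    rewrite /= in_itv/= => /andP[as_ sb].
    have h1 : k * A <= k * (alpha s).1.
      by move: as_; rewrite le_eqVlt => /predU1P[<-//|as_]; rewrite ltW// mono// (le_trans sb).
    have h2 : k * (alpha s).1 <= k * B.
      by move: sb; rewrite le_eqVlt => /predU1P[->//|sb]; rewrite ltW// mono// (le_trans aa').
    have /orP[/eqP kE|/eqP kE] : (k == 1) || (k == -1) by rewrite -eqf_sqr expr1n expr2 k1.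
      move: small h1 h2; rewrite /D kE !mul1r => small h1 h2.
      by have [] := dP A B _ A0 h1 h2 B1 (le_lt_trans small d'd).
    move: small h1 h2; rewrite /D kE !mulN1r !lerN2 !opprB => small h1 h2.
    by have [] := dP B A _ B0 h2 h1 A1 (le_lt_trans small d'd).
  have gpos s : `[a', b']%classic s -> 0 < g (alpha s).1.
    by move=> /sub/M01; exact: g_pos.
  have D0 : 0 < D.
    have sa' : `[a', b']%classic a' by rewrite /= in_itv/= lexx ltW.
    by rewrite -(pmulr_rgt0 _ (gpos a' sa')); exact: lt_le_trans (key a' sa').
  (* Stretching time by [c] makes the width of this piece equal to [D]. By [key], [1 <= c * g] along
     the piece, which turns causality for [g] into the link inequality. *)
  pose c := D / (k * (B - A)).
  have c0 : 0 < c by rewrite divr_gt0.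
  have DE : D = (k * c) * (B - A).
    by rewrite mulrAC mulrC /c divfK// gt_eqF.
  rewrite DE; apply: (link_of_curve ab' oU _ sa).
    by move=> s /sub; exact: abU.
  move=> s ch abs Xc cs; have [vk vs] := v s ch (sub _ abs) Xc cs.
  split; first by rewrite mulrAC mulr_gt0.
  have cg : 1 <= c * g (alpha s).1.
    by rewrite /c mulrAC ler_pdivlMr// mul1r [D * _]mulrC; exact: key.
  rewrite -mulrA [X in _ <= X]exprMn [k ^+ 2]expr2 k1 mul1r [X in _ <= X]exprMn.
  have := ler_wpM2l (sqr_ge0 c) vs; apply: le_trans.
  rewrite mulrA -exprMn ler_peMl//; first exact: speed2_ge0.
  by rewrite expr_ge1// (le_trans ler01).
(* Induction on the number of blocks of time extent [d'] that cover the rest of the curve. *)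
suff H (N : nat) a' : a <= a' -> a' < b ->
    k * ((alpha b).1 - (alpha a').1) <= N%:R * d' ->
    links sigma (alpha a').2 (alpha b).2
      ((1 + e) * (k * (T (alpha b).1 - T (alpha a').1))).
  apply: (H (Num.Def.archi_bound (k * ((alpha b).1 - (alpha a).1) / d'))) => //.
  rewrite -ler_pdivrMr// ltW// archi_boundP// divr_ge0 ?(ltW d'0)//.
  by rewrite mulrBr subr_ge0 ltW// mono.
elim: N a' => [|N IH] a' aa' ab' baN.
  by apply: short => //; rewrite (le_trans baN)// mul0r ltW.
have [bad|bad] := leP (k * ((alpha b).1 - (alpha a').1)) d'; first exact: short.
have [c [ac cb cE]] : exists c, [/\ a' < c, c < b & (alpha c).1 = (alpha a').1 + k * d'].
  have abU' : `[a', b] `<=` U.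
    by apply: subset_trans abU; apply: subset_itv; rewrite bnd_simp.
  apply: (time_ivt ab' oU abU' sa).
  have /orP[/eqP kE|/eqP kE] : (k == 1) || (k == -1) by rewrite -eqf_sqr expr1n expr2 k1.
    move: bad; rewrite kE !mul1r => bad; rewrite gt_min lt_max.
    by apply/andP; split; apply/orP; [left|right]; lra.
  move: bad; rewrite kE !mulN1r => bad; rewrite gt_min lt_max.
  by apply/andP; split; apply/orP; [right|left]; lra.
have kd : k * ((alpha c).1 - (alpha a').1) = d'.
  by rewrite cE addrC addKr mulrA k1 mul1r.
have -> : (1 + e) * (k * (T (alpha b).1 - T (alpha a').1)) =
    (1 + e) * (k * (T (alpha c).1 - T (alpha a').1)) +
    (1 + e) * (k * (T (alpha b).1 - T (alpha c).1)) by ring.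
apply: (links_trans (y := (alpha c).2)).
  by apply: short => //; [exact: ltW|rewrite kd].
apply: IH => //; first by rewrite (le_trans aa')// ltW.
move: baN; rewrite -natr1 mulrDl mul1r => baN.
have -> : k * ((alpha b).1 - (alpha c).1) =
  k * ((alpha b).1 - (alpha a').1) - k * ((alpha c).1 - (alpha a').1) by ring.
by rewrite kd lerBlDr.
Qed.

Lemma arc_links e p q : 0 < e -> causal_arc sigma t0 t1 g p q ->
  links sigma p.2 q.2 ((1 + e) * `|T q.1 - T p.1|).
Proof.
move=> e0 [a [b [beta [ab cb <- <- Mb]]]].
have in01 alpha s : (forall r, `[a, b]%classic r -> alpha r = beta r) ->
    `[a, b]%classic s -> t0 <= (alpha s).1 <= t1.
  by move=> ab_ abs; have [+ _] := Mb s abs; rewrite ab_// /= in_itv.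
have aS : `[a, b]%classic a by rewrite /= in_itv/= lexx ltW.
have bS : `[a, b]%classic b by rewrite /= in_itv/= lexx ltW.
have widen k l : k * k = 1 -> links sigma (beta a).2 (beta b).2 ((1 + e) * (k * l)) ->
    links sigma (beta a).2 (beta b).2 ((1 + e) * `|l|).
  move=> k1 h; apply: links_widen h _; rewrite ler_wpM2l ?addr_ge0 ?(ltW e0)//.
  rewrite (le_trans (ler_norm _))// normrM.
  have : `|k| ^+ 2 == 1 by rewrite real_normK ?num_real// expr2 k1.
  by rewrite sqrp_eq1// => /eqP ->; rewrite mul1r.
case: cb => -[alpha [[U [oU abU sa]] E] v].
  apply: (widen 1); first by rewrite mulr1.
  rewrite -!E//; apply: (curve_links _ e0 ab oU abU sa); first by rewrite mulr1.
    by move=> s; exact: in01.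
  move=> s c abs Xc cs; rewrite mul1r; exact/future_causalE/v.
apply: (widen (-1)); first by rewrite mulrNN mulr1.
rewrite -!E//; apply: (curve_links _ e0 ab oU abU sa); first by rewrite mulrNN mulr1.
  by move=> s; exact: in01.
move=> s c abs Xc cs; rewrite mulN1r oppr_gt0; exact/past_causalE/v.
Qed.

Lemma chain_links e p q l : 0 < e -> chain sigma t0 t1 T g p q l ->
  links sigma p.2 q.2 ((1 + e) * l).
Proof.
move=> e0; elim=> [{}p|{}p {}q r {}l pq _ IH]; first by rewrite mulr0; exact: links_nil.
by rewrite mulrDr; apply: links_trans IH; exact: arc_links.
Qed.

Lemma chain_length_ge f p q l : chain sigma t0 t1 T f p q l ->
  `|T q.1 - T p.1| <= l.
Proof.
elim=> [{}p|{}p {}q r {}l _ _ IH]; first by rewrite subrr normr0.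
rewrite -(subrKA (T q.1)) addrC (le_trans (ler_normD _ _))//.
by rewrite addrC addrC lerD2l.
Qed.

End Comparison.

(** * Upper bound for the null distance *)

Section UpperBound.
Context (R : realType) (n : nat) (S : topologicalType).
Context (X : smoothManifold R n S) (sigma : riemannianMetric X).
Variables (t0 t1 : R).
Hypothesis t01 : t0 < t1.
Variable g : R -> R.
Hypothesis g_cont : {within `[t0, t1], continuous g}.
Hypothesis g_pos : forall t, t0 <= t <= t1 -> 0 < g t.
Let T := primitive t0 (fun u => (g u)^-1).
Implicit Types (x y : S) (p q : R * S).

Let T_mono := inv_primitive_mono g_cont g_pos.
Let T_strict := inv_primitive_strict t01 g_cont g_pos.

Notation chain f := (chain sigma t0 t1 T f).

(** At an end of the time interval there is room on one side only, so the level is taken in the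
    direction of the farther end. *)
Lemma nearby_level (t r : R) : t0 <= t <= t1 -> 0 < r ->
  exists s, [/\ s != t, t0 <= s <= t1 & `|s - t| <= r].
Proof.
move=> /andP[a b] r0; pose h := Num.min r ((t1 - t0) / 2).
have h0 : 0 < h by rewrite lt_min r0 divr_gt0// subr_gt0.
have hr : h <= r by rewrite ge_min lexx.
have h2 : h <= (t1 - t0) / 2 by rewrite ge_min lexx orbT.
have [tm|tm] := leP t ((t0 + t1) / 2).
  exists (t + h); split.
  - by rewrite gt_eqF// ltrDl.
  - by apply/andP; split; lra.
  - by rewrite addrC addKr ger0_norm// ltW.
exists (t - h); split.
- by rewrite lt_eqF// ltrBlDr ltrDl.
- by apply/andP; split; lra.
- by rewrite addrC addKr normrN ger0_norm// ltW.
Qed.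

Section Metric.
Variable f : R -> R.
Hypothesis f_cont : {within `[t0, t1], continuous f}.
Hypothesis f_pos : forall t, t0 <= t <= t1 -> 0 < f t.
Let F := primitive t0 (fun u => (f u)^-1).

(** Only the empty chain needs an argument: it is replaced by a vertical excursion to a nearby level
    and back, of arbitrarily small null length. *)
Lemma null_distance_le p q l : t0 <= p.1 <= t1 -> chain f p q l ->
  (null_distance sigma t0 t1 f (fun p => T p.1) p q <= l%:E)%E.
Proof.
have main p' q' l' : (forall a, exists b s beta,
    [/\ piecewise_causal sigma t0 t1 f a b s beta,
    beta a = p', beta b = q' & null_length (fun p => T p.1) a b s beta = l']) ->
    (null_distance sigma t0 t1 f (fun p => T p.1) p' q' <= l'%:E)%E.
  move=> /(_ 0)[b [s [beta [pc bp bq <-]]]].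
  by apply: ereal_inf_lbound; exists 0, b, s, beta.
move=> Mp /chain_piecewise[[<- ->]|]; last exact: main.
apply/lee_addgt0Pr => e e0; rewrite add0e.
have [m [N m0 mN]] := cont_bounds t01 g_cont g_pos.
(* As [1 / g <= 1 / m], a height of [e * m / 2] costs at most [e / 2] in each direction. *)
have em0 : 0 < e * m / 2 by rewrite divr_gt0// mulr_gt0.
have [s [sp Ms close]] := nearby_level Mp em0.
case: p => [t x] /= in Mp sp close *.
have loop : chain f (t, x) (t, x) (`|T s - T t| + `|T t - T s|).
  by apply: (chain_trans (q := (s, x))); apply: vertical_chain.
(* Positive length rules out that the loop is again the degenerate case of [chain_piecewise]. *)
have l_gt0 : 0 < `|T s - T t|.
  rewrite normr_gt0 subr_eq0; move: sp; case: ltgtP => // st _.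
    by rewrite lt_eqF//; apply: T_strict => //; [case/andP: Ms|case/andP: Mp].
  by rewrite gt_eqF//; apply: T_strict => //; [case/andP: Mp|case/andP: Ms].
have l_le : `|T s - T t| <= e / 2.
  have hb u : t0 <= u <= t1 -> 0 <= (g u)^-1 <= m^-1.
    move=> u01; have /andP[mu _] := mN u u01; have gu := g_pos u01.
    by rewrite invr_ge0 ltW//= lef_pV2.
  have := primitive_lipschitz (cont_inv g_cont g_pos) (lexx _) (lexx _) hb Ms Mp.
  move/le_trans; apply; rewrite ler_pdivrMl// (le_trans close)//.
  by rewrite mulrCA mulrA.
have [[_ l0]|/main h] := chain_piecewise loop.
  by move: l0; rewrite [X in _ + X]distrC => /eqP; rewrite gt_eqF// addr_gt0.
by apply: le_trans h _; rewrite lee_fin [X in _ + X]distrC; lra.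
Qed.

(* The path goes up and down along short null curves near the level [t]. *)
Lemma zigzag_chain (c t w : R) x y : t0 <= t <= t1 -> f t < c * g t ->
  links sigma x y w -> exists2 l, l <= c * w & chain f (t, x) (t, y) l.
Proof.
move=> Mt fcg xy; have ft := f_pos Mt; have gt := g_pos Mt.
have w0 := links_ge0 xy.
have c0 : 0 < c by rewrite -(pmulr_lgt0 _ gt) (lt_trans ft).
(* Near [t] one has [f <= G], so slope [G] is causal for [f], and [G <= c * g], so a leg of width
   [om] and height [G * om] has null length at most [c * om]. *)
pose G := (f t + c * g t) / 2.
have [fG Gc] : f t < G /\ G < c * g t by rewrite /G; split; lra.
have G0 : 0 < G by exact: lt_trans fG.
have [r1 r10 r1P] : exists2 r, 0 < r & forall v, t0 <= v <= t1 -> `|t - v| < r -> f v <= G.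
  have [|r r0 rP] := cont_eps f_cont Mt (e := G - f t); first by rewrite subr_gt0.
  exists r => // v Mv /(rP v Mv); rewrite ltr_norml => /andP[h _]; lra.
have [r2 r20 r2P] : exists2 r, 0 < r & forall v, t0 <= v <= t1 -> `|t - v| < r ->
    G <= c * g v.
  have [|r r0 rP] := cont_eps g_cont Mt (e := g t - G / c).
    by rewrite subr_gt0 ltr_pdivrMr// mulrC.
  exists r => // v Mv /(rP v Mv); rewrite ltr_norml => /andP[_ h].
  by rewrite -ler_pdivrMl// mulrC ltW//; lra.
pose rho := Num.min r1 r2 / 2.
have rm0 : 0 < Num.min r1 r2 by rewrite lt_min r10.
have rho0 : 0 < rho by rewrite divr_gt0.
have [rho1 rho2] : rho < r1 /\ rho < r2.
  have : rho < Num.min r1 r2 by rewrite ltr_pdivrMr// ltr_pMr// ltr1n.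
  by rewrite lt_min => /andP.
have [s [st Ms close]] := nearby_level Mt rho0.
pose lo := Num.min s t; pose hi := Num.max s t.
have t0lo : t0 <= lo by rewrite le_min; case/andP: Ms => ->; case/andP: Mt => ->.
have hit1 : hi <= t1 by rewrite ge_max; case/andP: Ms => _ ->; case/andP: Mt => _ ->.
have near u : lo <= u <= hi -> t0 <= u <= t1 /\ `|t - u| <= rho.
  move=> /andP[lu uh]; split; first by rewrite (le_trans t0lo lu) (le_trans uh hit1).
  move: close lu uh; rewrite /lo /hi; case: (ltgtP s t) st => // lt _ close lu uh.
    by rewrite ger0_norm ?subr_ge0//; move: close; rewrite ler0_norm; lra.
  by rewrite ler0_norm ?subr_le0//; move: close; rewrite ger0_norm; lra.
pose sg : R := if t < s then 1 else -1.
have sg1 : `|sg| = 1 by rewrite /sg; case: ifP; rewrite ?normrN normr1.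
pose k := sg * G.
have kG : `|k| = G by rewrite normrM sg1 mul1r ger0_norm// ltW.
have k0 : k != 0 by rewrite -normr_gt0 kG.
have fk u : lo <= u <= hi -> 0 <= f u <= `|k|.
  move=> /near[Mu tu]; rewrite kG (ltW (f_pos Mu)) /=.
  by apply: r1P => //; exact: le_lt_trans rho1.
have fk' u : lo <= u <= hi -> 0 <= f u <= `|- k|.
  by rewrite normrN; exact: fk.
have d0 : 0 < `|s - t| by rewrite normr_gt0 subr_eq0.
(* [N] excursions with two legs of width [om] exhaust [w], and [N] is so large that a leg does not
   pass the level [s]. The successor makes [N] positive for the division. *)
pose N := (Num.Def.archi_bound (w * G / `|s - t|)).+1.
have NP : w * G <= N%:R * `|s - t|.
  rewrite -ler_pdivrMr//.
  have h := archi_boundP (divr_ge0 (mulr_ge0 w0 (ltW G0)) (ltW d0)).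
  by rewrite (le_trans (ltW h))// ler_nat leqnSn.
have N0 : 0 < N%:R :> R by rewrite ltr0n.
pose om := w / N%:R / 2.
have om0 : 0 <= om by rewrite !divr_ge0// ltW.
have wE : w = N%:R * (om + om).
  by rewrite /om -splitr mulrC divfK// gt_eqF.
have omG : om * G <= `|s - t|.
  have h : w / N%:R * G <= `|s - t| by rewrite mulrAC ler_pdivrMr// [leRHS]mulrC.
  have h' : 0 <= w / N%:R * G.
    by apply: mulr_ge0; [apply: divr_ge0; [exact: w0|exact: ltW]|exact: ltW].
  have -> : om * G = w / N%:R * G / 2 by rewrite /om mulrAC.
  by move: h h'; lra.
have tlh : lo <= t <= hi by rewrite /lo /hi ge_min le_max lexx !orbT.
have t'lh : lo <= t + k * om <= hi.
  have omG0 : 0 <= om * G by rewrite mulr_ge0// ltW.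
  move: omG; rewrite /k /lo /hi /sg -mulrA [G * om]mulrC.
  case: (ltgtP t s) st => //= lt _.
    by rewrite ger0_norm ?subr_ge0 ?(ltW lt)// mul1r => h; apply/andP; split; lra.
  by rewrite ler0_norm ?subr_le0 ?(ltW lt)// mulN1r => h; apply/andP; split; lra.
pose tau := `|T (t + k * om) - T t|.
have tau_le : tau <= c * om.
  have hb u : lo <= u <= hi -> 0 <= (g u)^-1 <= c / G.
    move=> /near[Mu tu]; have gu := g_pos Mu.
    have Gcu : G <= c * g u by apply: r2P => //; exact: le_lt_trans rho2.
    by rewrite invr_ge0 (ltW gu) /= ler_pdivlMr// mulrC ler_pdivrMr.
  have := primitive_lipschitz (cont_inv g_cont g_pos) t0lo hit1 hb t'lh tlh.
  move/le_trans; apply; rewrite [t + _]addrC addrK normrM kG (ger0_norm om0).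
  by rewrite mulrA divfK// gt_eqF.
suff H (j : nat) x' : links sigma x' y (j%:R * (om + om)) ->
    chain f (t, x') (t, y) (j%:R * (tau + tau)).
  exists (N%:R * (tau + tau)); last by apply: H; rewrite -wE.
  rewrite wE mulrCA; apply: ler_wpM2l; first exact: ltW.
  by rewrite mulrDr lerD.
elim: j x' => [|j IH] x'.
  rewrite !mul0r => l; have lam := lt0r_neq0 G0.
  have := block_chain T_mono (r := t) l k0 t0lo hit1 fk tlh.
  by rewrite mulr0 addr0 subrr normr0; apply.
rewrite -natr1 !mulrDl !mul1r => l.
have j0 : 0 <= j%:R * (om + om) by rewrite mulr_ge0// addr_ge0.
have [|z [xz zy]] := links_split l (u := om).
  by rewrite om0 /=; move: j0; rewrite mulrDr; lra.
have [|z' [zz' z'y]] := links_split zy (u := om).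
  by rewrite om0 /=; move: j0; rewrite mulrDr; lra.
have {}z'y : links sigma z' y (j%:R * (om + om)).
  suff <- : j%:R * (om + om) + (om + om) - om - om = j%:R * (om + om) by [].
  by ring.
have up := block_chain T_mono (r := t) xz k0 t0lo hit1 fk tlh t'lh.
have nk0 : - k != 0 by rewrite oppr_eq0.
have bE : t + k * om + - k * om = t by rewrite mulNr addrK.
have := block_chain T_mono (r := t + k * om) zz' nk0 t0lo hit1 fk' t'lh.
rewrite bE => /(_ tlh) down.
have := chain_trans up (chain_trans down (IH z' z'y)).
rewrite -/tau [`|T t - _|]distrC -/tau.
by have -> : tau + (tau + j%:R * (tau + tau)) = j%:R * (tau + tau) + (tau + tau) by ring.
Qed.

(** Moving from [t] to [s] absorbs the width [|F s - F t| / (1 + e)]; the rest is spent by zigzags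
    at the level [s'], reached and left vertically, whence the factor [2]. The maximum covers a move
    that absorbs everything. *)
Lemma chain_via (e c t s s' w : R) x y : 0 < e ->
  t0 <= t <= t1 -> t0 <= s <= t1 -> t0 <= s' <= t1 ->
  f s' < c * g s' -> links sigma x y w ->
  exists2 l, l <= `|T s - T t| + 2 * `|T s' - T s| +
      c * Num.max 0 (w - `|F s - F t| / (1 + e)) &
    chain f (t, x) (s, y) l.
Proof.
move=> e0 Mt Ms Ms' fcg xy.
have e1 : 0 < 1 + e by rewrite addr_gt0.
set w1 := `|F s - F t| / (1 + e).
have w10 : 0 <= w1 by rewrite divr_ge0// ltW.
have [z [xz zy]] : exists z, links sigma x z w1 /\ links sigma z y (Num.max 0 (w - w1)).
  have [ww|ww] := leP w w1.
    exists y; split; first exact: links_widen ww.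
    by rewrite max_l ?subr_le0//; exact: links_nil.
  rewrite max_r ?subr_ge0 ?ltW//; apply: links_split xy _.
  by rewrite w10 ltW.
have go := transport t01 T_mono f_cont f_pos e0 Mt Ms xz.
have [l lc zig] := zigzag_chain Ms' fcg zy.
have v1 := vertical_chain sigma t01 T_mono f_cont f_pos z Ms Ms'.
have v2 := vertical_chain sigma t01 T_mono f_cont f_pos y Ms' Ms.
exists (`|T s - T t| + (`|T s' - T s| + (l + `|T s - T s'|))).
  by rewrite [`|T s - T s'|]distrC; lra.
exact: chain_trans go (chain_trans v1 (chain_trans zig v2)).
Qed.

(** With [w = (1 + e) * l] and [c = 1 + e] the zigzags cost [(1 + e) ^+ 2 * l - |F q.1 - F p.1|]. Up
    to [E] the subtracted term cancels the cost [|T q.1 - T p.1|] of the climb. *)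
Lemma null_distance_compare (e E h : R) p q (d : R) : 0 < e -> 0 <= E -> 0 <= h ->
  t0 <= p.1 <= t1 -> t0 <= q.1 <= t1 ->
  (forall s t, t0 <= s -> s <= t -> t <= t1 -> (T t - T s) - (F t - F s) <= E) ->
  (exists s, [/\ t0 <= s <= t1, `|T s - T q.1| <= h & f s < (1 + e) * g s]) ->
  (null_distance sigma t0 t1 g (fun p => T p.1) p q < d%:E)%E ->
  (null_distance sigma t0 t1 f (fun p => T p.1) p q
     <= ((1 + e) ^+ 2 * d + E + 2 * h)%:E)%E.
Proof.
move=> e0 E0 h0 Mp Mq close [s [Ms sh fs]] /null_distance_chain_lt[l ld pq].
have e1 : 0 < 1 + e by rewrite addr_gt0.
have xy := chain_links g_cont g_pos e0 pq.
have Tl := chain_length_ge pq; rewrite -/T in Tl.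
have l0 : 0 <= l by exact: le_trans Tl.
have TF : `|T q.1 - T p.1| - E <= `|F q.1 - F p.1|.
  case/andP: Mp => p0 p1; case/andP: Mq => q0 q1.
  have [pq'|/ltW qp] := leP p.1 q.1.
    have := close _ _ p0 pq' q1.
    have Tpq := T_mono p0 pq' q1; rewrite -/T in Tpq.
    rewrite [`|T _ - _|]ger0_norm ?subr_ge0//.
    by have := ler_norm (F q.1 - F p.1); lra.
  have := close _ _ q0 qp p1.
  have Tpq := T_mono q0 qp p1; rewrite -/T in Tpq.
  rewrite [`|T _ - _|]ler0_norm ?subr_le0// [`|F _ - _|]distrC.
  by have := ler_norm (F p.1 - F q.1); lra.
case: p q Mp Mq pq xy Tl sh TF => [t x] [t' y] /= Mp Mq pq xy Tl sh TF.
have [l' l'le c'] := chain_via e0 Mp Mq Ms fs xy.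
have := null_distance_le (p := (t, x)) Mp c'; move/le_trans; apply; rewrite lee_fin.
apply: (le_trans l'le).
have big : (1 + e) ^+ 2 * l <= (1 + e) ^+ 2 * d.
  by rewrite ler_wpM2l ?sqr_ge0// ltW.
have l_le : l <= (1 + e) ^+ 2 * l.
  by rewrite ler_peMl// exprn_ege1// lerDl ltW.
(* When no width remains, the climb alone costs [|T q.1 - T p.1|], which is at most [l]. *)
have [neg|pos] := leP ((1 + e) * l - `|F t' - F t| / (1 + e)) 0.
  by rewrite mulr0; lra.
have -> : (1 + e) * ((1 + e) * l - `|F t' - F t| / (1 + e)) =
    (1 + e) ^+ 2 * l - `|F t' - F t|.
  by field; rewrite gt_eqF.
lra.
Qed.

End Metric.

(** A crude use of [chain_via] for [g] itself, with zigzags at the level of the end point and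
    [e = 1], [c = 2]. *)
Lemma null_distance_bounded (W : R) : (forall x y, links sigma x y W) ->
  exists K, forall p q, t0 <= p.1 <= t1 -> t0 <= q.1 <= t1 ->
    (null_distance sigma t0 t1 g (fun p => T p.1) p q <= K%:E)%E.
Proof.
move=> links_W; exists (T t1 + 2 * `|W|) => -[t x] [s y] /= Mt Ms.
have gs : g s < 2 * g s by rewrite ltr_pMl ?g_pos// ltr1n.
have [l l_le c] := chain_via g_cont g_pos ltr01 Mt Ms Ms gs (links_W x y).
apply: le_trans (null_distance_le g_cont g_pos (p := (t, x)) Mt c) _.
rewrite lee_fin (le_trans l_le)// subrr normr0 mulr0 addr0 lerD//.
  have [t_0 t_1] := andP Mt; have [s_0 s_1] := andP Ms.
  have T0 : T t0 = 0 by exact: primitive_t0.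
  have := T_mono (lexx _) t_0 t_1; have := T_mono t_0 t_1 (lexx _).
  have := T_mono (lexx _) s_0 s_1; have := T_mono s_0 s_1 (lexx _).
  rewrite -!/T T0 => *; rewrite ler_norml; apply/andP; split; lra.
rewrite ler_wpM2l// ge_max normr_ge0 /= lerBlDr.
by rewrite (le_trans (ler_norm W))// lerDl divr_ge0.
Qed.

End UpperBound.

(** * Uniform convergence *)

Section Convergence.
Context (R : realType) (n : nat) (S : topologicalType).
Context (X : smoothManifold R n S) (sigma : riemannianMetric X).
Variables (t0 t1 : R).
Hypothesis t01 : t0 < t1.
Implicit Types (f g : R -> R) (tau : R * S -> R) (p q : R * S).

Lemma causal_curve_antitone f g a b beta :
  (forall t, t0 <= t <= t1 -> 0 < g t <= f t) ->
  (forall s, `[a, b]%classic s -> t0 <= (beta s).1 <= t1) ->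
  causal_curve sigma f a b beta -> causal_curve sigma g a b beta.
Proof.
move=> gf M01.
have sq_le alpha (c : chart R n S) s v w : `[a, b]%classic s -> atlas X c ->
    cdom c (alpha s).2 -> smooth_extension X a b beta alpha ->
    f (alpha s).1 ^+ 2 * speed2 sigma c (alpha s).2 v <= w ->
    g (alpha s).1 ^+ 2 * speed2 sigma c (alpha s).2 v <= w.
  move=> abs Xc cs [_ E]; apply: le_trans.
  have /andP[g0 gf'] : 0 < g (alpha s).1 <= f (alpha s).1.
    by apply: gf; rewrite E//; exact: M01.
  apply: ler_wpM2r; first exact: speed2_ge0.
  by rewrite lerXn2r ?nnegrE// ltW// (lt_le_trans g0).
case=> -[alpha sa v]; [left|right]; exists alpha => // s c abs Xc cs.
  have /future_causalE[v0 vs] := v s c abs Xc cs.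
  by apply/future_causalE; split=> //; exact: sq_le vs.
have /past_causalE[v0 vs] := v s c abs Xc cs.
by apply/past_causalE; split=> //; exact: sq_le vs.
Qed.

Lemma null_distance_antitone f g tau p q :
  (forall t, t0 <= t <= t1 -> 0 < g t <= f t) ->
  (null_distance sigma t0 t1 g tau p q <= null_distance sigma t0 t1 f tau p q)%E.
Proof.
move=> gf; apply: ereal_inf_le_tmp => _ [a [b [s [beta [[ab pb Mb piece] bp bq ->]]]]].
exists a, b, s, beta; split=> //; split=> // i si.
apply: causal_curve_antitone gf _ (piece i si) => x; rewrite /= in_itv/= => /andP[ix xi].
have /andP[ai _] := partition_nth i pb; have /andP[_ ib] := partition_nth i.+1 pb.
have [] : spacetime t0 t1 (beta x).
  by apply: Mb; rewrite /= in_itv/= (le_trans ai ix) (le_trans xi ib).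
by rewrite /= in_itv.
Qed.

Lemma null_distance_ge0 f tau p q : (0 <= null_distance sigma t0 t1 f tau p q)%E.
Proof.
apply: le_ereal_inf_tmp => _ [a [b [s [beta [_ _ _ ->]]]]].
by rewrite lee_fin; apply: sumr_ge0.
Qed.

Variables (f : nat -> R -> R) (g : R -> R).
Hypothesis g_pos : forall t, t0 <= t <= t1 -> 0 < g t.
Hypothesis f_cont : forall j, {within `[t0, t1], continuous (f j)}.
Hypothesis g_cont : {within `[t0, t1], continuous g}.
Hypothesis f_ge : forall j t, t0 <= t <= t1 -> g t <= f j t.
Hypothesis f_L1 : (fun j : nat =>
  primitive t0 (fun t => `|f j t - g t|) t1) @ \oo --> (0 : R).
Let T := primitive t0 (fun u => (g u)^-1).

Let f_pos j t : t0 <= t <= t1 -> 0 < f j t.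
Proof. by move=> Mt; apply: lt_le_trans (f_ge j Mt); exact: g_pos. Qed.

(** The additive error [e * m] becomes the factor [1 + e] because [g] is at least [m]. The interval
    of length [h] is placed on the side of [s] where there is room. *)
Lemma near_level_of_L1 (h e : R) (m : R) j s : 0 < h -> h <= (t1 - t0) / 2 ->
  (forall t, t0 <= t <= t1 -> m <= g t) -> 0 < e ->
  primitive t0 (fun t => `|f j t - g t|) t1 < e * m * h ->
  t0 <= s <= t1 ->
  exists u, [/\ t0 <= u <= t1, `|u - s| <= h & f j u < (1 + e) * g u].
Proof.
move=> h0 h2 mg e0 small /andP[s0 s1].
have eg u : t0 <= u <= t1 -> f j u < g u + e * m -> f j u < (1 + e) * g u.
  move=> Mu /lt_le_trans; apply; rewrite mulrDl mul1r lerD2l.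
  by rewrite ler_wpM2l ?(ltW e0)// mg.
have [sm|sm] := leP s ((t0 + t1) / 2).
  have [|||u /andP[su us] fu] := near_point_of_L1 (e := e * m) (@f_cont j) g_cont s0 (t := s + h).
  - by rewrite lerDl ltW.
  - by lra.
  - by rewrite addrC addKr.
  have Mu : t0 <= u <= t1 by apply/andP; split; lra.
  exists u; split=> //; last exact: eg.
  by rewrite ger0_norm ?subr_ge0//; lra.
have [||||u /andP[su us] fu] := near_point_of_L1 (e := e * m) (@f_cont j) g_cont (s := s - h) (t := s).
- by lra.
- by rewrite gerBl ltW.
- by [].
- by rewrite subKr.
have Mu : t0 <= u <= t1 by apply/andP; split; lra.
exists u; split=> //; last exact: eg.
by rewrite ler0_norm ?subr_le0//; lra.
Qed.

Lemma null_distance_eventually_close (W eps : R) :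
  (forall x y, links sigma x y W) -> 0 < eps ->
  \forall j \near \oo, forall p q, spacetime t0 t1 p -> spacetime t0 t1 q ->
    exists D Dj : R,
    [/\ null_distance sigma t0 t1 g (fun p => T p.1) p q = D%:E,
        null_distance sigma t0 t1 (f j) (fun p => T p.1) p q = Dj%:E &
        `|Dj - D| <= eps].
Proof.
move=> links_W eps0.
have [K KP] := null_distance_bounded t01 g_cont g_pos links_W.
have [m [N m0 mN]] := cont_bounds t01 g_cont g_pos.
have mg t : t0 <= t <= t1 -> m <= g t by move=> /mN/andP[].
pose K' := `|K| + 1.
have K'0 : 0 < K' by rewrite ltr_wpDl.
(* Error budget: for [e <= 1] the factor [(1 + e) ^+ 2] adds at most [3 * (e * K')], hence
   [eps / 4]; the climb adds [eps / 4], the vertical detour [2 * (eps / 8)], and the choice of [l]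
   below [eps / 8]. *)
pose e := Num.min 1 (eps / (12 * K')).
have e0 : 0 < e by rewrite lt_min ltr01 divr_gt0// mulr_gt0.
have e1 : e <= 1 by rewrite ge_min lexx.
have eK : e * K' * 12 <= eps.
  have : e <= eps / (12 * K') by rewrite ge_min lexx orbT.
  by rewrite ler_pdivlMr ?mulr_gt0// [12 * _]mulrC mulrA.
pose h := Num.min ((t1 - t0) / 2) (eps / 8 * m).
have h0 : 0 < h by rewrite lt_min !divr_gt0 ?subr_gt0//= mulr_gt0// divr_gt0.
have h2 : h <= (t1 - t0) / 2 by rewrite ge_min lexx.
have hm : h <= eps / 8 * m by rewrite ge_min lexx orbT.
(* The first bound yields a good level within [h] of that of [q], the second makes the two conformal
   times [eps / 4]-close. *)
pose small := Num.min (e * m * h) (eps / 4 * m ^+ 2).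
have small0 : 0 < small by rewrite lt_min !mulr_gt0 ?divr_gt0 ?exprn_gt0.
have : \forall j \near \oo, `|0 - primitive t0 (fun t => `|f j t - g t|) t1| < small.
  by move/cvgrPdist_lt: f_L1; apply.
apply: filterS => j /=; rewrite sub0r normrN => /(le_lt_trans (ler_norm _)).
rewrite lt_min => /andP[I1 I2] p q [/= Mp _] [/= Mq _].
rewrite in_itv/= in Mp; rewrite in_itv/= in Mq.
set d := null_distance sigma t0 t1 g _ p q.
have d_fin : d \is a fin_num.
  by rewrite ge0_fin_numE ?null_distance_ge0// (le_lt_trans (KP p q Mp Mq)) ?ltry.
exists (fine d); have dE : d = (fine d)%:E by rewrite fineK.
have D0 : 0 <= fine d by rewrite fine_ge0// null_distance_ge0.
have DK : fine d <= `|K|.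
  by rewrite (le_trans _ (ler_norm K))// -lee_fin fineK//; exact: KP.
(* The infimum need not be attained, so a value strictly above it is compared; the minimum with [1]
   keeps [l] below [K']. *)
pose l := fine d + Num.min 1 (eps / 8).
have ld : fine d < l by rewrite ltrDl lt_min ltr01 divr_gt0.
have lK : l <= K' by rewrite lerD// ge_min lexx.
have leps : l <= fine d + eps / 8 by rewrite lerD2l ge_min lexx orbT.
have mgf u : t0 <= u <= t1 -> m <= g u <= f j u.
  by move=> Mu; rewrite mg//= f_ge.
have close s t : t0 <= s -> s <= t -> t <= t1 -> (T t - T s) -
    (primitive t0 (fun u => (f j u)^-1) t - primitive t0 (fun u => (f j u)^-1) s)
    <= eps / 4.
  move=> s0 st t1'.
  apply: le_trans (primitive_inv_close (@f_cont j) g_cont m0 mgf s0 st t1') _.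
  by rewrite ler_pdivrMl ?exprn_gt0// mulrC ltW.
have near_q : exists s, [/\ t0 <= s <= t1, `|T s - T q.1| <= eps / 8 &
    f j s < (1 + e) * g s].
  have [u [Mu uh fu]] := near_level_of_L1 h0 h2 mg e0 I1 Mq; exists u; split=> //.
  have hb v : t0 <= v <= t1 -> 0 <= (g v)^-1 <= m^-1.
    move=> Mv; have gv := g_pos Mv.
    by rewrite invr_ge0 (ltW gv) /= lef_pV2 ?posrE// mg.
  have := primitive_lipschitz (cont_inv g_cont g_pos) (lexx _) (lexx _) hb Mu Mq.
  move/le_trans; apply; rewrite ler_pdivrMl// (le_trans uh)// (le_trans hm)//.
  by rewrite mulrC.
have eps4 : 0 <= eps / 4 by rewrite divr_ge0// ltW.
have eps8 : 0 <= eps / 8 by rewrite divr_ge0// ltW.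
have dl : (d < l%:E)%E by rewrite dE lte_fin.
have upper := null_distance_compare t01 g_cont g_pos (@f_cont j) (@f_pos j)
  e0 eps4 eps8 Mp Mq close near_q dl.
have lower : (d <= null_distance sigma t0 t1 (f j) (fun p => T p.1) p q)%E.
  by apply: null_distance_antitone => t Mt; rewrite g_pos//= f_ge.
set dj := null_distance sigma t0 t1 (f j) _ p q in upper lower *.
have dj_fin : dj \is a fin_num.
  by rewrite ge0_fin_numE ?null_distance_ge0// (le_lt_trans upper) ?ltry.
have djE : dj = (fine dj)%:E by rewrite fineK.
exists (fine dj); split => //.
move: upper lower; rewrite dE djE !lee_fin => upper lower.
rewrite ger0_norm ?subr_ge0//.
have l0 : 0 <= l by rewrite (le_trans D0)// ltW.
have el : (1 + e) ^+ 2 * l <= l + 3 * (e * K').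
  have : e * l <= e * K' by rewrite ler_wpM2l// ltW.
  have : e * (e * l) <= 1 * (e * l) by rewrite ler_wpM2r// mulr_ge0// ltW.
  have -> : (1 + e) ^+ 2 * l = l + 2 * (e * l) + e * (e * l) by ring.
  by lra.
by lra.
Qed.

End Convergence.

Theorem theorem1p1 (R : realType) (n : nat) (S : topologicalType)
  (X : smoothManifold R n S) (sigma : riemannianMetric X)
  (S_compact : compact [set: S])
  (S_connected : connected [set: S]) (S_nonempty : [set: S] !=set0)
  (t0 t1 : R) (t01 : t0 < t1)
  (f : nat -> R -> R) (foo : R -> R)
  (f_pos : forall j t, t0 <= t <= t1 -> 0 < f j t)
  (foo_pos : forall t, t0 <= t <= t1 -> 0 < foo t)
  (f_cont : forall j, {within `[t0, t1], continuous (f j)})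
  (foo_cont : {within `[t0, t1], continuous foo})
  (f_L1 : (fun j : nat =>
     \int[lebesgue_measure]_(t in `[t0, t1]) `|f j t - foo t|) @ \oo --> (0 : R))
  (f_ge : forall j t, t0 <= t <= t1 -> foo t <= f j t) :
  let tau : R * S -> R := conformal_time t0 foo in
  let M : set (R * S) := @spacetime R S t0 t1 in
  (fun j : nat => ereal_sup
     [set `|null_distance sigma t0 t1 (f j) tau pq.1 pq.2
            - null_distance sigma t0 t1 foo tau pq.1 pq.2|%E
      | pq in M `*` M]) @ \oo --> (0 : R)%:E.
Proof.
move=> tau M.
have [W links_W] := links_bounded sigma S_compact S_connected S_nonempty.
set u := (fun j : nat => ereal_sup _).
have u_small eps : 0 < eps -> \forall j \near \oo, (0 <= u j <= eps%:E)%E.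
  move=> eps0.
  have := null_distance_eventually_close t01 foo_pos f_cont foo_cont f_ge f_L1 links_W eps0.
  apply: filterS => j close; apply/andP; split.
    (* A supremum over the empty set would be [-oo]; a point of [M] makes it nonnegative. *)
    have [x _] := S_nonempty.
    have Mx : M (t0, x) by split=> //=; rewrite in_itv/= lexx ltW.
    apply: le_trans (ereal_sup_ubound _); last by exists ((t0, x), (t0, x)).
    exact: abse_ge0.
  apply: ge_ereal_sup => _ [[p q] [/= Mp Mq] <-].
  have [D [Dj [dE djE DD]]] := close p q Mp Mq.
  (* [tau] unfolds to the primitive of [1 / foo] at the first coordinate, so [dE] applies by
     conversion. *)
  rewrite (_ : null_distance sigma t0 t1 foo tau p q = D%:E)//.
  rewrite (_ : null_distance sigma t0 t1 (f j) tau p q = Dj%:E)//.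
apply/fine_cvgP; split.
  have := u_small 1 ltr01; apply: filterS => j /andP[u0 u1].
  by rewrite ge0_fin_numE// (le_lt_trans u1)// ltry.
apply/cvgrPdist_le => eps eps0; have := u_small eps eps0.
apply: filterS => j /andP[u0 u1] /=; rewrite sub0r normrN.
have ufin : u j \is a fin_num by rewrite ge0_fin_numE// (le_lt_trans u1)// ltry.
by rewrite ger0_norm ?fine_ge0// -lee_fin fineK.
Qed.
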